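(* Let $\mathbb{K}$ be an algebraically closed field of characteristic zero, let $X=(X_1,\ldots,X_n)$, let $d\ge 2$, and let $$P(Z)=Z^d+a_1(X)Z^{d-1}+\cdots+a_d(X)\in\mathbb{K}[[X]][Z]$$ be a quasi-ordinary Weierstrass polynomial such that $a_1=0$. Then the ideal $\bigl(a_i^{d!/i}(X)\bigr)_{i=2,\ldots,d}$ of $\mathbb{K}[[X]]$ is monomial and generated by one of the $a_i^{d!/i}(X)$, $i\in\{2,\ldots,d\}$.
   Context: $\mathbb{N}$ contains $0$. A monic polynomial $P\in\mathbb{K}[[X]][Z]$ is called quasi-ordinary if its discriminant with respect to $Z$ has the form $\Delta_P(X)=X_1^{\alpha_1}\cdots X_n^{\alpha_n}U(X)$ with $\alpha_i\in\mathbb{N}$ and $U\in\mathbb{K}[[X]]$, $U(0)\neq 0$. It is called a Weierstrass polynomial if $a_i(0)=0$ for all $i=1,\ldots,d$. The conclusion ''monomial and generated by one of the $a_i^{d!/i}$'' means: there is $i_0\in\{2,\ldots,d\}$ such that $a_{i_0}^{d!/i_0}$ is a monomial times a unit of $\mathbb{K}[[X]]$ and generates the ideal generated by all the $a_i^{d!/i}$, $i=2,\ldots,d$. *)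

(* Defs.v *)
From HB Require Import structures.
From mathcomp Require Import all_boot all_order all_algebra.
From mathcomp Require Import boolp classical_sets.
From mathcomp Require Import mpoly.

Set Implicit Arguments.
Unset Strict Implicit.
Unset Printing Implicit Defensive.

Import GRing.Theory.

Local Open Scope ring_scope.

(* Formal power series K[[X_1, ..., X_n]], as families of coefficients indexed
   by the multi-exponents 'X_{1..n} of the multinomials library. *)
Record mseries (n : nat) (K : Type) := MSeries { scoef : 'X_{1..n} -> K }.

Section MSeriesRing.
Variables (n : nat) (K : comNzRingType).
Local Notation S := (mseries n K).
Implicit Types (f g h : S) (m : 'X_{1..n}) (b : nat).

HB.instance Definition _ := gen_eqMixin S.
HB.instance Definition _ := gen_choiceMixin S.

Lemma mseriesP f g : (forall m, scoef f m = scoef g m) <-> f = g.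
Proof.
by split=> [|-> //]; case: f g => [f] [g] /= fg; congr MSeries; apply/funext.
Qed.

Definition mseries_monom m : S := MSeries (fun k => (k == m)%:R).
Definition mseries_zero : S := MSeries (fun=> 0).
Definition mseries_opp f : S := MSeries (fun m => - scoef f m).
Definition mseries_add f g : S := MSeries (fun m => scoef f m + scoef g m).

(* Cauchy product: the sum ranges over all pairs of exponents (k.1, k.2) with
   k.1 + k.2 = m; the degree bound only serves to make the index type finite
   (compare mcoeffM for polynomials). *)
Definition mseries_mul f g : S := MSeries (fun m =>
  \sum_(k : 'X_{1..n < (mdeg m).+1, (mdeg m).+1} | m == (k.1 + k.2)%MM)
    scoef f k.1 * scoef g k.2).

Fact mseries_addA : associative mseries_add.
Proof. by move=> f g h; apply/mseriesP=> m; rewrite /= addrA. Qed.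

Fact mseries_addC : commutative mseries_add.
Proof. by move=> f g; apply/mseriesP=> m; rewrite /= addrC. Qed.

Fact mseries_add0 : left_id mseries_zero mseries_add.
Proof. by move=> f; apply/mseriesP=> m; rewrite /= add0r. Qed.

Fact mseries_addN : left_inverse mseries_zero mseries_opp mseries_add.
Proof. by move=> f; apply/mseriesP=> m; rewrite /= addNr. Qed.

HB.instance Definition _ := GRing.isZmodule.Build S
  mseries_addA mseries_addC mseries_add0 mseries_addN.

(* The ring axioms are inherited from polynomials by truncation. *)
Definition mseries_trunc b f : {mpoly K[n]} :=
  \sum_(m : 'X_{1..n < b}) (scoef f m *: 'X_[m]).

Lemma mcoeff_trunc b f m : (mdeg m < b)%N -> (mseries_trunc b f)@_m = scoef f m.
Proof. exact: mcoeff_mpoly. Qed.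

Lemma mcoeffM_local (p q p' q' : {mpoly K[n]}) m :
  (forall k, (mdeg k <= mdeg m)%N -> p@_k = p'@_k) ->
  (forall k, (mdeg k <= mdeg m)%N -> q@_k = q'@_k) ->
  (p * q)@_m = (p' * q')@_m.
Proof.
move=> pp qq; rewrite !mcoeffM; apply: eq_bigr=> -[k1 k2] /= _.
by rewrite pp ?qq // -ltnS bmdeg.
Qed.

Lemma scoefM b f g m : (mdeg m < b)%N ->
  scoef (mseries_mul f g) m = (mseries_trunc b f * mseries_trunc b g)@_m.
Proof.
move=> ltmb; rewrite mcoeffM /=; apply: eq_bigr => -[k1 k2] /= _.
by rewrite !mcoeff_trunc // (leq_trans (bmdeg _)).
Qed.

Lemma mcoeff_truncM b f g m : (mdeg m < b)%N ->
  (mseries_trunc b (mseries_mul f g))@_m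
    = (mseries_trunc b f * mseries_trunc b g)@_m.
Proof. by move=> ltmb; rewrite mcoeff_trunc // (scoefM _ _ ltmb). Qed.

Fact mseries_mulA : associative mseries_mul.
Proof.
move=> f g h; apply/mseriesP=> m; rewrite !(scoefM _ _ (ltnSn _)).
transitivity ((mseries_trunc (mdeg m).+1 f * mseries_trunc (mdeg m).+1 g
                * mseries_trunc (mdeg m).+1 h)@_m).
  rewrite -mulrA; apply: mcoeffM_local => // k lekm.
  by rewrite mcoeff_truncM.
by apply: mcoeffM_local => // k lekm; rewrite mcoeff_truncM.
Qed.

Fact mseries_mulC : commutative mseries_mul.
Proof.
by move=> f g; apply/mseriesP=> m; rewrite !(scoefM _ _ (ltnSn _)) mulrC.
Qed.

Fact mseries_mul1 : left_id (mseries_monom 0%MM) mseries_mul.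
Proof.
move=> f; apply/mseriesP=> m; rewrite (scoefM _ _ (ltnSn _)).
rewrite -[RHS](mcoeff_trunc _ (ltnSn _)) -[in RHS](mul1r (mseries_trunc _ _)).
apply: mcoeffM_local => // k lekm.
by rewrite mcoeff_trunc // mcoeff1.
Qed.

Fact mseries_mulD : left_distributive mseries_mul +%R.
Proof.
move=> f g h; apply/mseriesP=> m /=; rewrite -big_split /=.
by apply: eq_bigr => k _; rewrite mulrDl.
Qed.

Fact mseries_one_neq0 : mseries_monom 0%MM != 0.
Proof.
apply/eqP=> /mseriesP/(_ 0%MM) /=; rewrite eqxx => /eqP.
by rewrite oner_eq0.
Qed.

HB.instance Definition _ := GRing.Zmodule_isComNzRing.Build S
  mseries_mulA mseries_mulC mseries_mul1 mseries_mulD mseries_one_neq0.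

Definition mseries_unit : {pred S} := fun f => `[< exists g, g * f = 1 >].

Definition mseries_inv f : S :=
  if pselect (exists g, g * f = 1) is left e then projT1 (cid e) else f.

Fact mseries_mulVf : {in mseries_unit, left_inverse 1 mseries_inv *%R}.
Proof.
move=> f /asboolP uf; rewrite /mseries_inv; case: pselect => // e.
exact: (projT2 (cid e)).
Qed.

Fact mseries_unitPl f g : g * f = 1 -> mseries_unit f.
Proof. by move=> gf; apply/asboolP; exists g. Qed.

Fact mseries_inv_out : {in [predC mseries_unit], mseries_inv =1 id}.
Proof.
move=> f /negP nuf; rewrite /mseries_inv; case: pselect => // e.
by case: nuf; apply/asboolP.
Qed.

HB.instance Definition _ := GRing.ComNzRing_hasMulInverse.Build S
  mseries_mulVf mseries_unitPl mseries_inv_out.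

End MSeriesRing.

(* Discriminant of a monic polynomial. The resultant is the determinant of the
   Sylvester matrix of formats given by the actual degrees of p and p^`(); over
   an algebra of characteristic zero these are d and d - 1 when p is monic of
   degree d. *)
Definition discriminant (R : comNzRingType) (p : {poly R}) : R :=
  (-1) ^+ 'C((size p).-1, 2) * resultant p p^`().

Definition quasi_ordinary (n : nat) (K : comNzRingType)
    (P : {poly mseries n K}) : Prop :=
  P \is monic /\
  exists (alpha : 'X_{1..n}) (U : mseries n K),
    scoef U 0%MM != 0 /\ discriminant P = mseries_monom K alpha * U.

Definition weierstrass (n : nat) (K : comNzRingType)
    (P : {poly mseries n K}) : Prop :=
  P \is monic /\
  forall k : nat, (k < (size P).-1)%N -> scoef P`_k 0%MM = 0.

Definition monomial_times_unit (n : nat) (K : comNzRingType)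
    (f : mseries n K) : Prop :=
  exists (alpha : 'X_{1..n}) (U : mseries n K),
    U \is a GRing.unit /\ f = mseries_monom K alpha * U.

Definition ideal_gen (R : comNzRingType) (s : seq R) : set R :=
  [set x | exists c : nat -> R, x = \sum_(i < size s) c i * s`_i].

(* Main.v *)
Require Import Defs.
From HB Require Import structures.
From mathcomp Require Import all_boot all_order all_algebra.
From mathcomp Require Import boolp classical_sets.
From mathcomp Require Import mpoly.
From mathcomp Require Import fingroup perm ring zify.

Set Implicit Arguments.
Unset Strict Implicit.
Unset Printing Implicit Defensive.

Import GRing.Theory.

Local Open Scope ring_scope.

(** By the Abhyankar-Jung theorem the roots z_i of P would be power series in
    fractional powers of the variables, and the differences z_i - z_j, being
    divisors of the discriminant, would be monomials times units; the relation
    (z_i - z_k) - (z_j - z_k) = z_i - z_j makes their exponents comparable, and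
    since the z_i have sum zero, the smallest exponent governs all coefficients.
    The proof below follows this idea without constructing roots in several
    variables.

    P is pulled back along monomial curves X_i = s^(mu_i) t^(w_i), with positive
    weights w_i. By the Newton-Puiseux theorem, applied over K and then over the
    field of Laurent series in s, the image of P splits over K((s))[[t]] once the
    mu_i and w_i are multiplied by a common integer ([test_curve_splits]). There
    s d/ds lifts the derivation D = sum_i mu_i X_i d/dX_i; it acts on the
    coefficients of a series in t, so that it does not decrease the order in t,
    and the logarithmic derivatives h_ij = D(z_i - z_j) / (z_i - z_j) are power
    series in t.

    Multiplied by a power of the discriminant, the product of the T - h_ij becomes
    a symmetric polynomial in the roots, hence comes from a polynomial F with
    coefficients in K[[X]], which does not depend on w
    ([logarithmic_derivative_poly]). This power of the discriminant is a monomial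
    times a unit, and it divides F along all curves, hence in K[[X]]
    ([F_divisible]). So the product of the T - h_ij comes from K[[X]], and at t = 0
    it becomes a polynomial over K. As K is algebraically closed, all h_ij(0) lie
    in K ([log_derivative_constant]): the leading coefficients of the differences of
    roots are eigenvectors of s d/ds with eigenvalues in K.

    Eigenvectors for distinct eigenvalues are independent, so the triangle
    relation and the vanishing of the sum of the roots give the leading
    coefficients of all roots a common eigenvalue l ([common_eigenvalue]). The
    initial form of a_i on the face of weight w is then an eigenvector with
    eigenvalue i l. When mu separates exponents, this says that all exponents m of
    a_i on that face have the same m / i, which does not depend on i
    ([faces_are_points]). A Newton polyhedron all of whose faces of positive weight
    are points has a single vertex ([single_vertex]); it belongs to some a_(i0),
    which is therefore a monomial times a unit, and a_(i0)^(d!/i0) divides all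
    a_i^(d!/i). *)

(** * Power series in one variable *)

(** The equations F g = g can be solved when they are triangular for a measure:
    the iterates of F become stationary at each index. Coefficients of inverses
    and of Hensel factors are obtained in this way. *)
Lemma recursion_on_measure (I A : Type) (mes : I -> nat)
    (F : (I -> A) -> I -> A) (a0 : A) :
  (forall g g' i, (forall j, (mes j < mes i)%N -> g j = g' j) -> F g i = F g' i) ->
  exists g, forall i, g i = F g i.
Proof.
move=> extF; pose G k := iter k F (fun=> a0).
have stab k l i : (mes i < k)%N -> (mes i < l)%N -> G k i = G l i.
  elim: k l i => // k IH [//|l] i; rewrite !ltnS => ik il.
  by apply: extF => j ji; apply: IH; apply: leq_trans ji _.
exists (fun i => G (mes i).+1 i) => i; rewrite {1}/G iterS -/(G _).
by apply: extF => j ji; apply: stab.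
Qed.

Record fps (A : Type) := Fps { fcoef : nat -> A }.

Section FpsRing.
Variable A : comNzRingType.
Local Notation S := (fps A).
Implicit Types f g h : S.

HB.instance Definition _ := gen_eqMixin S.
HB.instance Definition _ := gen_choiceMixin S.

Lemma fpsP f g : (forall k, fcoef f k = fcoef g k) <-> f = g.
Proof.
by split=> [|-> //]; case: f g => [f] [g] /= fg; congr Fps; apply/funext.
Qed.

Definition fps_const c : S := Fps (fun k => if k is 0%N then c else 0).
Definition fps_opp f : S := Fps (fun k => - fcoef f k).
Definition fps_add f g : S := Fps (fun k => fcoef f k + fcoef g k).
Definition fps_mul f g : S :=
  Fps (fun k => \sum_(i < k.+1) fcoef f i * fcoef g (k - i)%N).

Fact fps_addA : associative fps_add.
Proof. by move=> f g h; apply/fpsP=> k; rewrite /= addrA. Qed.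

Fact fps_addC : commutative fps_add.
Proof. by move=> f g; apply/fpsP=> k; rewrite /= addrC. Qed.

Fact fps_add0 : left_id (fps_const 0) fps_add.
Proof. by move=> f; apply/fpsP=> -[|k]; rewrite /= add0r. Qed.

Fact fps_addN : left_inverse (fps_const 0) fps_opp fps_add.
Proof. by move=> f; apply/fpsP=> -[|k]; rewrite /= addNr. Qed.

HB.instance Definition _ := GRing.isZmodule.Build S
  fps_addA fps_addC fps_add0 fps_addN.

(** Truncation to a polynomial carries the ring axioms over from [{poly A}]. *)
Definition fps_trunc b f : {poly A} := \poly_(i < b) fcoef f i.

Lemma coef_trunc b f k : (k < b)%N -> (fps_trunc b f)`_k = fcoef f k.
Proof. by move=> kb; rewrite coef_poly kb. Qed.

Lemma fcoefM_trunc b f g k : (k < b)%N ->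
  fcoef (fps_mul f g) k = (fps_trunc b f * fps_trunc b g)`_k.
Proof.
move=> kb; rewrite coefM /=; apply: eq_bigr => i _.
by rewrite !coef_trunc //; apply: leq_ltn_trans kb; rewrite ?leq_subr // -ltnS.
Qed.

Lemma coefM_local (p q p' q' : {poly A}) k :
  (forall i, (i <= k)%N -> p`_i = p'`_i) ->
  (forall i, (i <= k)%N -> q`_i = q'`_i) -> (p * q)`_k = (p' * q')`_k.
Proof.
move=> pp qq; rewrite !coefM; apply: eq_bigr => i _.
by rewrite pp ?qq ?leq_subr // -ltnS.
Qed.

Fact fps_mulA : associative fps_mul.
Proof.
move=> f g h; apply/fpsP=> k; rewrite !(fcoefM_trunc _ _ (ltnSn _)).
transitivity ((fps_trunc k.+1 f * fps_trunc k.+1 g * fps_trunc k.+1 h)`_k).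
  rewrite -mulrA; apply: coefM_local => // i ik.
  by rewrite coef_trunc // (@fcoefM_trunc k.+1).
by apply: coefM_local => // i ik; rewrite coef_trunc // (@fcoefM_trunc k.+1).
Qed.

Fact fps_mulC : commutative fps_mul.
Proof.
by move=> f g; apply/fpsP=> k; rewrite !(fcoefM_trunc _ _ (ltnSn _)) mulrC.
Qed.

Fact fps_mul1 : left_id (fps_const 1) fps_mul.
Proof.
move=> f; apply/fpsP=> k /=; rewrite big_ord_recl /= mul1r subn0.
by rewrite big1 ?addr0 // => i _; rewrite mul0r.
Qed.

Fact fps_mulD : left_distributive fps_mul +%R.
Proof.
move=> f g h; apply/fpsP=> k /=; rewrite -big_split /=.
by apply: eq_bigr => i _; rewrite mulrDl.
Qed.

Fact fps_one_neq0 : fps_const 1 != 0.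
Proof.
by apply/eqP=> /fpsP/(_ 0%N) /= /eqP; rewrite oner_eq0.
Qed.

HB.instance Definition _ := GRing.Zmodule_isComNzRing.Build S
  fps_mulA fps_mulC fps_mul1 fps_mulD fps_one_neq0.

Definition fps_unit : {pred S} := fun f => `[< exists g, g * f = 1 >].

Definition fps_inv f : S :=
  if pselect (exists g, g * f = 1) is left e then projT1 (cid e) else f.

Fact fps_mulVf : {in fps_unit, left_inverse 1 fps_inv *%R}.
Proof.
move=> f /asboolP uf; rewrite /fps_inv; case: pselect => // e.
exact: (projT2 (cid e)).
Qed.

Fact fps_unitPl f g : g * f = 1 -> fps_unit f.
Proof. by move=> gf; apply/asboolP; exists g. Qed.

Fact fps_inv_out : {in [predC fps_unit], fps_inv =1 id}.
Proof.
move=> f /negP nuf; rewrite /fps_inv; case: pselect => // e.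
by case: nuf; apply/asboolP.
Qed.

HB.instance Definition _ := GRing.ComNzRing_hasMulInverse.Build S
  fps_mulVf fps_unitPl fps_inv_out.

Lemma fcoef0 k : fcoef (0 : S) k = 0.
Proof. by case: k. Qed.

Lemma fcoef1 k : fcoef (1 : S) k = (k == 0%N)%:R.
Proof. by case: k. Qed.

Lemma fcoefD f g k : fcoef (f + g) k = fcoef f k + fcoef g k.
Proof. by []. Qed.

Lemma fcoefB f g k : fcoef (f - g) k = fcoef f k - fcoef g k.
Proof. by []. Qed.

Lemma fcoefM f g k :
  fcoef (f * g) k = \sum_(i < k.+1) fcoef f i * fcoef g (k - i)%N.
Proof. by []. Qed.

Lemma fcoef_sum I (r : seq I) (Q : pred I) (F : I -> S) k :
  fcoef (\sum_(i <- r | Q i) F i) k = \sum_(i <- r | Q i) fcoef (F i) k.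
Proof. by elim/big_rec2: _ => [|i y x _ <-] //; rewrite fcoef0. Qed.

Fact fps_const_additive : additive fps_const.
Proof. by move=> x y; apply/fpsP=> -[|k]; rewrite /= ?subr0. Qed.

Fact fps_const_multiplicative : multiplicative fps_const.
Proof.
split=> // x y; apply/fpsP=> k; rewrite fcoefM big_ord_recl /= subn0.
rewrite big1 ?addr0 => [|i _]; last by rewrite mul0r.
by case: k => [|k] //=; rewrite mulr0.
Qed.

HB.instance Definition _ := GRing.isAdditive.Build A S fps_const
  fps_const_additive.
HB.instance Definition _ := GRing.isMultiplicative.Build A S fps_const
  fps_const_multiplicative.

Lemma fcoef_constM c f k : fcoef (fps_const c * f) k = c * fcoef f k.
Proof.
rewrite fcoefM big_ord_recl /= subn0 big1 ?addr0 // => i _.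
by rewrite mul0r.
Qed.

Definition residue f := fcoef f 0.

Fact residue_additive : additive residue.
Proof. by []. Qed.

Fact residue_multiplicative : multiplicative residue.
Proof. by split=> // f g; rewrite /residue fcoefM big_ord1. Qed.

HB.instance Definition _ := GRing.isAdditive.Build S A residue
  residue_additive.
HB.instance Definition _ := GRing.isMultiplicative.Build S A residue
  residue_multiplicative.

Definition tpow e : S := Fps (fun k => (k == e)%:R).

Lemma fcoef_tpow e k : fcoef (tpow e) k = (k == e)%:R.
Proof. by []. Qed.

Lemma fcoef_tpowM e f k :
  fcoef (tpow e * f) k = if (k < e)%N then 0 else fcoef f (k - e)%N.
Proof.
rewrite fcoefM; case: ltnP => [ke|ek].
  rewrite big1 // => i _ /=; case: eqP => [ie|_]; last by rewrite mul0r.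
  by move: (ltn_ord i); rewrite ie ltnS leqNgt ke.
have ek' : (e < k.+1)%N by rewrite ltnS.
rewrite (bigD1 (Ordinal ek')) //= eqxx mul1r big1 ?addr0 // => i.
by rewrite -val_eqE /= => /negbTE ->; rewrite mul0r.
Qed.

Lemma tpow0 : tpow 0 = 1.
Proof. by apply/fpsP=> k; rewrite fcoef1. Qed.

Lemma tpowD e e' : tpow (e + e')%N = tpow e * tpow e'.
Proof.
apply/fpsP=> k; rewrite fcoef_tpowM /=; case: ltnP => [ke|ek].
  by rewrite ltn_eqF // (leq_trans ke) // leq_addr.
by rewrite -{1}(subnKC ek) eqn_add2l.
Qed.

Lemma tpowM e m : tpow (e * m)%N = tpow e ^+ m.
Proof.
elim: m => [|m IH]; first by rewrite muln0 tpow0.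
by rewrite mulnS tpowD IH exprS.
Qed.

Lemma tpow_divides e f :
  (forall k, (k < e)%N -> fcoef f k = 0) ->
  f = tpow e * Fps (fun k => fcoef f (k + e)%N).
Proof.
move=> f0; apply/fpsP=> k; rewrite fcoef_tpowM.
by case: ltnP => [/f0 //|ek] /=; rewrite subnK.
Qed.

Lemma tpow_reg e f : tpow e * f = 0 -> f = 0.
Proof.
move=> tf; apply/fpsP=> k; rewrite fcoef0.
move/fpsP: tf => /(_ (e + k)%N).
by rewrite fcoef_tpowM fcoef0 ltnNge leq_addr addKn.
Qed.

Lemma tpow_neq0 e : tpow e != 0.
Proof.
apply/eqP=> te; have := oner_neq0 S.
by rewrite (tpow_reg (e := e) (f := 1)) ?eqxx // mulr1.
Qed.

Lemma fps_order f : f != 0 ->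
  exists e g, residue g != 0 /\ f = tpow e * g.
Proof.
move=> f0; have ex : exists k, fcoef f k != 0.
  apply: contrapT => nex; move/negP: f0; apply; apply/eqP/fpsP=> k.
  by rewrite fcoef0; apply: contrapT => /eqP fk; apply: nex; exists k.
exists (ex_minn ex); case: ex_minnP => e fe min.
exists (Fps (fun k => fcoef f (k + e)%N)); split=> //.
apply: tpow_divides => k ke; apply/eqP; apply: contraLR ke => fk.
by rewrite -leqNgt min.
Qed.

Lemma fps_unitP f c : c * residue f = 1 -> f \is a GRing.unit.
Proof.
move=> cf; pose F (g : nat -> A) k :=
  c * ((k == 0%N)%:R - \sum_(i < k) fcoef f (k - i)%N * g i).
have [|g gE] := @recursion_on_measure nat A id F 0.
  move=> g g' k gg'; rewrite /F; congr (_ * (_ - _)).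
  by apply: eq_bigr => i _; rewrite gg'.
apply/unitrP; have fg : Fps g * f = 1.
  apply/fpsP=> k; rewrite fcoefM fcoef1 big_ord_recr /= subnn gE /F.
  rewrite mulrC mulrA [fcoef f 0 * c]mulrC cf mul1r addrC -addrA.
  rewrite [X in _ + (_ + X)](eq_bigr _ (fun i _ => mulrC _ _)).
  by rewrite addNr addr0.
by exists (Fps g); split=> //; rewrite mulrC.
Qed.

End FpsRing.

Section FpsDomain.
Variable A : idomainType.

Fact fps_integral : GRing.integral_domain_axiom (fps A).
Proof.
move=> f g fg; apply/norP; case.
move=> /fps_order [e [f' [f'0 fE]]] /fps_order [e' [g' [g'0 gE]]].
move/eqP: fg; rewrite fE gE mulrACA -tpowD => /eqP /tpow_reg.
move/(congr1 (@residue _)); rewrite rmorphM rmorph0 => /eqP.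
by rewrite mulf_eq0 (negbTE f'0) (negbTE g'0).
Qed.

HB.instance Definition _ := GRing.ComUnitRing_isIntegral.Build (fps A)
  fps_integral.

End FpsDomain.

(** * Hensel's lemma *)

(** A polynomial over A[[t]] is handled as the sequence of its coefficients of
    t^k, which are polynomials over A. *)
Section Layers.
Variable A : comNzRingType.
Implicit Types p q : {poly fps A}.

Definition layer k p : {poly A} := map_poly (fun f => fcoef f k) p.

Lemma coef_layer k p j : (layer k p)`_j = fcoef p`_j k.
Proof. by rewrite coef_map_id0 // fcoef0. Qed.

Lemma layerP p q : (forall k, layer k p = layer k q) -> p = q.
Proof.
by move=> pq; apply/polyP=> j; apply/fpsP=> k; rewrite -!coef_layer pq.
Qed.

Lemma layerM k p q :
  layer k (p * q) = \sum_(i < k.+1) layer i p * layer (k - i) q.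
Proof.
apply/polyP=> j; rewrite coef_layer coefM fcoef_sum coef_sum.
under [RHS]eq_bigr => i _.
  rewrite coefM; under eq_bigr => l _ do rewrite !coef_layer.
  over.
by rewrite exchange_big.
Qed.

Lemma layer0 p : layer 0 p = map_poly (@residue A) p.
Proof. by []. Qed.

Definition unlayer m (G : nat -> {poly A}) : {poly fps A} :=
  \poly_(j < m) Fps (fun k => (G k)`_j).

Lemma unlayerK m (G : nat -> {poly A}) k : (size (G k) <= m)%N -> layer k (unlayer m G) = G k.
Proof.
move=> Gm; apply/polyP=> j; rewrite coef_layer coef_poly.
case: ltnP => // mj; rewrite fcoef0 nth_default //.
exact: leq_trans mj.
Qed.

Lemma unlayer_monic m (G : nat -> {poly A}) : G 0%N \is monic -> size (G 0%N) = m ->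
  (forall k, (0 < k)%N -> (size (G k) < m)%N) ->
  unlayer m G \is monic /\ size (unlayer m G) = m.
Proof.
move=> monG szG szG'; case: m szG szG' => [|m] szG szG'.
  by move/eqP: szG; rewrite size_poly_eq0 (negbTE (monic_neq0 monG)).
have lead1 : Fps (fun k => (G k)`_m) = 1 :> fps A.
  apply/fpsP=> -[|k] /=.
    by move/monicP: monG; rewrite lead_coefE szG.
  by rewrite nth_default // -ltnS szG'.
have sz : size (unlayer m.+1 G) = m.+1.
  by rewrite size_poly_eq //= lead1 oner_neq0.
split=> //; rewrite monicE lead_coefE sz coef_poly ltnSn.
by rewrite lead1.
Qed.

End Layers.

Section Hensel.
Variable E : fieldType.
Implicit Types g h c : {poly E}.

(** Reducing a Bezout combination modulo g bounds the degree of one cofactor,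
    and the degree of c then bounds the other. *)
Lemma coprime_decomposition g h c : g \is monic -> h \is monic ->
  coprimep g h -> (size c < size (g * h)%R)%N ->
  exists ab : {poly E} * {poly E},
    [/\ (size ab.1 < size g)%N, (size ab.2 < size h)%N
      & c = g * ab.2 + ab.1 * h].
Proof.
move=> mg mh /Bezout_eq1_coprimepP [[u v] /= uv] szc.
have g0 := monic_neq0 mg; have h0 := monic_neq0 mh.
pose a := (c * v) %% g; pose b := c * u + (c * v) %/ g * h.
have cE : c = g * b + a * h.
  have aE : a = c * v - (c * v) %/ g * g by apply/eqP; rewrite eq_sym subr_eq addrC -divp_eq.
  by rewrite -[LHS]mulr1 -uv aE /b; ring.
have sza : (size a < size g)%N by rewrite ltn_modp.
exists (a, b); split=> //=.
have [->|b0] := eqVneq b 0; first by rewrite size_poly0 size_poly_gt0.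
have : (size (g * b)%R < size (g * h)%R)%N.
  have -> : g * b = c - a * h by rewrite cE addrK.
  apply: leq_ltn_trans (size_polyD _ _) _; rewrite size_polyN gtn_max szc.
  have [->|a0] := eqVneq a 0.
    by rewrite mul0r size_poly0 size_poly_gt0 mulf_neq0.
  rewrite !size_mul // -!subn1 ltn_sub2r ?ltn_add2r //.
  by rewrite -[1%N]addn0 -addnS leq_add ?size_poly_gt0.
rewrite !size_mul // -!subn1 -!addnBA ?size_poly_gt0 // ltn_add2l.
by move=> lt; rewrite -(subnK (n := size b) (m := 1)) ?size_poly_gt0 //
  -(subnK (n := size h) (m := 1)) ?size_poly_gt0 // ltn_add2r.
Qed.

Lemma leq_pred2_add (a b m l : nat) :
  (a < m)%N -> (b < l)%N -> ((a + b).-1 <= (m + l).-2)%N.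
Proof. lia. Qed.

(** The coefficients of t^k in the two factors solve a linear equation whose
    right-hand side involves only lower coefficients, and coprimality of the
    residual factors makes it solvable. *)
Lemma hensel (P : {poly fps E}) g h : P \is monic ->
  g \is monic -> h \is monic -> coprimep g h ->
  map_poly (@residue E) P = g * h ->
  exists G H : {poly fps E},
    [/\ G \is monic, H \is monic, size G = size g, size H = size h & P = G * H].
Proof.
move=> mP mg mh cop resP; set m := size g; set l := size h.
have solvable (c : {poly E}) : exists ab : {poly E} * {poly E},
    (size c < size (g * h)%R)%N ->
    [/\ (size ab.1 < m)%N, (size ab.2 < l)%N & c = g * ab.2 + ab.1 * h].
  case: (ltnP (size c) (size (g * h)%R)) => [szc|_]; last by exists (0, 0).
  by have [ab abP] := coprime_decomposition mg mh cop szc; exists ab.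
have [solve solveP] := choice solvable.
(* The contribution to the k-th equation of the coefficients 1, ..., k - 1. *)
pose rest (s : nat -> {poly E} * {poly E}) k :=
  \sum_(i < k.+1 | (0 < i < k)%N) (s i).1 * (s (k - i)%N).2.
pose F s k := if k == 0%N then (g, h) else solve (layer k P - rest s k).
have [|s sE] := @recursion_on_measure nat _ id F 0.
  move=> s s' k ss'; rewrite /F; case: eqP => // k0; congr (solve (_ - _)).
  apply: eq_bigr => i /andP[i0 ik]; rewrite !ss' // ltn_subrL i0.
  by apply: leq_trans i0 (ltnW ik).
have s0 : s 0%N = (g, h) by rewrite sE.
have szgh : size (g * h) = (m + l).-1 by rewrite size_mul ?monic_neq0.
have szP : size P = size (g * h).
  rewrite -resP size_map_poly_id0 // (monicP mP) rmorph1; exact: oner_neq0.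
have m0 : (0 < m)%N by rewrite size_poly_gt0 monic_neq0.
have l0 : (0 < l)%N by rewrite size_poly_gt0 monic_neq0.
have sP k : (0 < k)%N -> [/\ (size (s k).1 < m)%N, (size (s k).2 < l)%N
    & layer k P = g * (s k).2 + (s k).1 * h + rest s k].
  elim/ltn_ind: k => k IH k0.
  have szc : (size (layer k P - rest s k)%R < size (g * h)%R)%N.
    have szle : (size (layer k P - rest s k)%R <= (size (g * h)%R).-1)%N.
      apply/leq_sizeP => j; rewrite -szP => jP.
      rewrite coefB coef_layer coef_sum big1 ?subr0.
        move: jP; rewrite leq_eqVlt => /predU1P[<-|jP].
          rewrite -lead_coefE (monicP mP) fcoef1.
          by rewrite (negbTE (lt0n_neq0 k0)).
        by rewrite nth_default ?fcoef0 //; apply: leq_trans jP; rewrite leqSpred.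
      move=> i /andP[i0 ik]; apply: nth_default.
      have [si _ _] := IH i ik i0.
      have [|//|_ sj _] := IH (k - i)%N; first by rewrite ltn_subrL i0 k0.
        by rewrite subn_gt0.
      apply: leq_trans (size_polyMleq _ _) _; apply: leq_trans jP.
      by rewrite szP szgh (leq_pred2_add si sj).
    by apply: leq_ltn_trans szle _; rewrite szgh; move: m0 l0; lia.
  have [s1 s2 /eqP] := solveP _ szc.
  rewrite sE /F (negbTE (lt0n_neq0 k0)) subr_eq => /eqP e.
  by split=> //; rewrite {1}e addrC.
have szG k : (size (s k).1 <= m)%N.
  by case: k => [|k]; rewrite ?s0 //; case: (sP k.+1 isT) => /ltnW.
have szH k : (size (s k).2 <= l)%N.
  by case: k => [|k]; rewrite ?s0 //; case: (sP k.+1 isT) => _ /ltnW.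
pose G := unlayer m (fun k => (s k).1); pose H := unlayer l (fun k => (s k).2).
have [||k k0|mG sG] := @unlayer_monic _ m (fun k => (s k).1);
  rewrite ?s0 //; first by case: (sP k k0).
have [||k k0|mH sH] := @unlayer_monic _ l (fun k => (s k).2);
  rewrite ?s0 //; first by case: (sP k k0).
exists G, H; split=> //; apply: layerP => k.
rewrite layerM.
under eq_bigr => i _ do rewrite !unlayerK //.
case: k => [|k]; first by rewrite big_ord1 s0 /= layer0 resP.
have [_ _ ->] := sP k.+1 isT.
rewrite big_ord_recl big_ord_recr /= subn0 s0 /= subnn s0 /= -addrA.
congr (_ + _); rewrite addrC; congr (_ + _).
rewrite /rest big_mkcond big_ord_recl /= add0r big_ord_recr /=.
rewrite [bump 0 k]add1n ltnn addr0.
by apply: eq_bigr => i _; rewrite /bump /= add1n ltnS ltn_ord.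
Qed.

End Hensel.

(** * Splitting after ramification *)

Definition splits (A : comNzRingType) (p : {poly A}) :=
  exists rs : seq A, p = \prod_(r <- rs) ('X - r%:P).

Section Splits.
Variable A : comNzRingType.
Implicit Types p q : {poly A}.

Lemma splitsM p q : splits p -> splits q -> splits (p * q).
Proof. by move=> [rs ->] [ss ->]; exists (rs ++ ss); rewrite big_cat. Qed.

Lemma splits_map (B : comNzRingType) (f : {rmorphism A -> B}) p :
  splits p -> splits (map_poly f p).
Proof.
by move=> [rs ->]; exists (map f rs); rewrite map_prod_XsubC big_map.
Qed.

Lemma splits_shift p c : splits (p \Po ('X - c%:P)) -> splits p.
Proof.
move=> [rs rsE]; exists [seq r - c | r <- rs].
have -> : p = (p \Po ('X - c%:P)) \Po ('X + c%:P).
  by have := comp_polyXaddC_K p (- c); rewrite polyCN opprK => ->.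
rewrite rsE rmorph_prod big_map; apply: eq_bigr => r _ /=.
by rewrite comp_polyB comp_polyX comp_polyC polyCB opprB addrA addrAC.
Qed.

(** Elementary symmetric functions are homogeneous. *)
Lemma coef_prod_scale c (rs : seq A) n : (n <= size rs)%N ->
  (\prod_(r <- rs) ('X - (c * r)%:P))`_n =
  c ^+ (size rs - n) * (\prod_(r <- rs) ('X - r%:P))`_n.
Proof.
move=> nrs; rewrite -(big_map (fun r => c * r) xpredT (fun r => 'X - r%:P)).
rewrite !coef_prod_XsubC ?size_map // mulrCA; congr (_ * _).
rewrite mulr_sumr; apply: eq_bigr => I /eqP <-.
rewrite -prodr_const -big_split; apply: eq_bigr => i _ /=.
by rewrite (nth_map 0).
Qed.

Lemma splits_scale d c p q : p \is monic -> size p = d.+1 ->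
  q \is monic -> size q = d.+1 ->
  (forall j, (j < d)%N -> p`_j = c ^+ (d - j) * q`_j) -> splits q -> splits p.
Proof.
move=> mp sp mq sq pq [rs qE]; exists [seq c * r | r <- rs].
have srs : size rs = d by move: sq; rewrite qE size_prod_XsubC => -[].
rewrite big_map; apply/polyP => j.
case: (ltngtP j d) => [jd|dj|->].
- by rewrite coef_prod_scale ?srs ?pq ?qE // ltnW.
- by rewrite !nth_default ?size_prod_XsubC ?srs ?sp.
- have := monicP mp; rewrite lead_coefE sp => ->.
  have := lead_coef_prod_XsubC rs xpredT (fun r => c * r).
  by rewrite lead_coefE size_prod_XsubC srs => ->.
Qed.

End Splits.

(** A family of endomorphisms [psi N] with psi_M psi_N = psi_(M N)
    models the passage to N-th roots of the uniformizers: [psi N] substitutes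
    the N-th power of each variable for that variable. *)
Section RamifiedSplitting.
Variables (A : comNzRingType) (psi : nat -> {rmorphism A -> A}).
Hypothesis psiM : forall M N x,
  (0 < M)%N -> (0 < N)%N -> psi M (psi N x) = psi (M * N)%N x.
Implicit Types p q : {poly A}.

Definition ram_splits p :=
  exists2 N, (0 < N)%N & splits (map_poly (psi N) p).

Definition ram_closed := forall p, p \is monic -> ram_splits p.

Lemma map_psiM M N p : (0 < M)%N -> (0 < N)%N ->
  map_poly (psi M) (map_poly (psi N) p) = map_poly (psi (M * N)%N) p.
Proof. by move=> M0 N0; apply/polyP=> i; rewrite !coef_map /= psiM. Qed.

Lemma ram_splits_psi M p :
  (0 < M)%N -> ram_splits (map_poly (psi M) p) -> ram_splits p.
Proof.
move=> M0 [N N0]; rewrite map_psiM // => sp.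
by exists (N * M)%N; rewrite ?muln_gt0 ?N0.
Qed.

Lemma ram_splitsM p q : ram_splits p -> ram_splits q -> ram_splits (p * q).
Proof.
move=> [M M0 sp] [N N0 sq]; exists (M * N)%N; first by rewrite muln_gt0 M0.
rewrite rmorphM /=; apply: splitsM.
  by rewrite mulnC -map_psiM //; apply: splits_map.
by rewrite -map_psiM //; apply: splits_map.
Qed.

Lemma ram_splits_shift p c : ram_splits (p \Po ('X - c%:P)) -> ram_splits p.
Proof.
move=> [N N0 sp]; exists N => //; move: sp.
by rewrite map_comp_poly rmorphB /= map_polyX map_polyC; apply: splits_shift.
Qed.

Lemma ram_splits_scale d c p q : p \is monic -> size p = d.+1 ->
  q \is monic -> size q = d.+1 ->
  (forall j, (j < d)%N -> p`_j = c ^+ (d - j) * q`_j) ->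
  ram_splits q -> ram_splits p.
Proof.
move=> mp sp mq sq pq [N N0 sqN]; exists N => //.
apply: (@splits_scale _ d (psi N c) _ (map_poly (psi N) q)) => //;
  rewrite ?monic_map ?size_map_poly_id0 //.
- by rewrite (monicP mp) rmorph1 oner_neq0.
- by rewrite (monicP mq) rmorph1 oner_neq0.
by move=> j jd; rewrite !coef_map /= pq // rmorphM rmorphXn.
Qed.

End RamifiedSplitting.

(** The substitution of t^N for t combined with f on the coefficients. *)
Section FpsRam.
Variables (A : comNzRingType) (N : nat) (f : {rmorphism A -> A}).

Definition fram (g : fps A) : fps A :=
  Fps (fun k => if (N %| k)%N then f (fcoef g (k %/ N)) else 0).

Fact fram_additive : additive fram.
Proof.
move=> g h; apply/fpsP=> k; rewrite fcoefB /=.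
by case: ifP; rewrite ?subr0 // rmorphB.
Qed.

Lemma fcoef_fram_trunc b g k : (0 < N)%N -> (k < b)%N ->
  fcoef (fram g) k = (map_poly f (fps_trunc b g) \Po 'X^N)`_k.
Proof.
move=> N0 kb; rewrite coef_comp_poly_Xn //=; case: ifP => // Nk.
by rewrite coef_map /= coef_trunc // (leq_ltn_trans (leq_div _ _)).
Qed.

Fact fram_multiplicative : multiplicative fram.
Proof.
split=> [g h|]; apply/fpsP=> k; last first.
  have -> : fcoef (fram 1) k = if (N %| k)%N then f (k %/ N == 0)%N%:R else 0.
    by rewrite -fcoef1.
  rewrite fcoef1; case: k => [|k]; first by rewrite dvdn0 div0n rmorph1.
  case: ifP => // /dvdnP[[|m] km] //; rewrite km.
  case: (posnP N) => [N0|N0]; first by rewrite N0 muln0 in km.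
  by rewrite mulnK // -km rmorph0.
have [N0|N0] := posnP N.
  rewrite fcoefM /= N0; case: k => [|k].
    by rewrite !big_ord1 /= rmorphM.
  rewrite dvd0n /= big1 // => -[[|i] ik] _; last by rewrite dvd0n /= mul0r.
  by rewrite subn0 !dvd0n /= mulr0.
have := @fcoefM_trunc _ k.+1 (fram g) (fram h) k (ltnSn k).
rewrite -[fps_mul _ _]/(fram g * fram h) => ->.
rewrite (fcoef_fram_trunc _ N0 (ltnSn k)).
transitivity (((map_poly f (fps_trunc k.+1 g) \Po 'X^N)
   * (map_poly f (fps_trunc k.+1 h) \Po 'X^N))`_k); last first.
  apply: coefM_local => i ik; rewrite coef_trunc // -fcoef_fram_trunc //.
rewrite -rmorphM -[X in _ = (X \Po _)`_k]rmorphM /= !coef_comp_poly_Xn //.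
case: ifP => // Nk; rewrite !coef_map /=; congr (f _).
by rewrite coef_trunc -?fcoefM_trunc // ltnS leq_div.
Qed.

HB.instance Definition _ := GRing.isAdditive.Build (fps A) (fps A) fram
  fram_additive.
HB.instance Definition _ := GRing.isMultiplicative.Build (fps A) (fps A) fram
  fram_multiplicative.

End FpsRam.

Definition fps_psi (A : comNzRingType) (psi : nat -> {rmorphism A -> A}) N :
  {rmorphism fps A -> fps A} := fram N (psi N).

Lemma fps_psiM (A : comNzRingType) (psi : nat -> {rmorphism A -> A}) :
  (forall M N x, (0 < M)%N -> (0 < N)%N -> psi M (psi N x) = psi (M * N)%N x) ->
  forall M N x, (0 < M)%N -> (0 < N)%N ->
  fps_psi psi M (fps_psi psi N x) = fps_psi psi (M * N)%N x.
Proof.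
move=> psiM M N x M0 N0; apply/fpsP=> k /=.
have [Mk|nMk] := boolP (M %| k)%N; last first.
  by case: ifP => // /(dvdn_trans (dvdn_mulr _ (dvdnn _))); rewrite (negbTE nMk).
have -> : (M * N %| k)%N = (N %| k %/ M)%N.
  by rewrite -[k in LHS](divnK Mk) mulnC dvdn_pmul2r.
case: ifP => _; last by rewrite rmorph0.
by rewrite divnMA psiM.
Qed.

(** * The Newton-Puiseux theorem *)

Lemma shift_kills_subleading (A : comNzRingType) d (p : {poly A}) c :
  p \is monic -> size p = d.+2 -> p`_d = d.+1%:R * c ->
  let q := p \Po ('X - c%:P) in
  [/\ q \is monic, size q = d.+2 & q`_d = 0].
Proof.
move=> mp sp pd q.
have lX : forall m, (('X - c%:P) ^+ m)`_m = 1.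
  by move=> m; have /monicP := monic_exp m (monicXsubC c);
    rewrite lead_coefE size_exp_XsubC.
have subX : (('X - c%:P) ^+ d.+1)`_d = - (d.+1%:R * c).
  have := @coefPn_prod_XsubC _ (nseq d.+1 c) isT.
  rewrite !big_nseq size_nseq [d.+1.-1]/=.
  by rewrite iter_mulr mulr1 iter_addr_0 mulr_natl.
have qE : q = ('X - c%:P) ^+ d.+1 + p`_d *: ('X - c%:P) ^+ d
              + \sum_(i < d) p`_i *: ('X - c%:P) ^+ i.
  rewrite /q comp_polyE sp !big_ord_recr /=.
  have := monicP mp; rewrite lead_coefE sp => ->.
  by rewrite scale1r addrC -addrA; congr (_ + _); rewrite addrC.
have szr k : (d <= k)%N -> (\sum_(i < d) p`_i *: ('X - c%:P) ^+ i)`_k = 0.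
  move=> dk; rewrite coef_sum big1 // => i _.
  rewrite coefZ [X in _ * X]nth_default ?mulr0 // size_exp_XsubC.
  exact: leq_trans (ltn_ord i) dk.
have q1 : q`_d.+1 = 1.
  rewrite qE !coefD szr ?leqnSn // lX coefZ.
  by rewrite [_`_d.+1]nth_default ?size_exp_XsubC // mulr0 !addr0.
have sq : size q = d.+2.
  apply/eqP; rewrite eqn_leq; apply/andP; split.
    by rewrite -sp; apply: leq_trans (size_comp_poly_leq _ _) _;
      rewrite size_XsubC muln1 prednK ?sp.
  by rewrite ltnNge; apply/negP=> /leq_sizeP/(_ d.+1 (leqnn _))/eqP;
    rewrite q1 oner_eq0.
split=> //; first by rewrite monicE lead_coefE sq q1.
by rewrite qE !coefD szr // subX coefZ lX mulr1 pd addNr addr0.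
Qed.

(** The roots have sum zero; were they all equal, a nonzero multiple of the
    common root would vanish and p would be a power of X. So one root can be
    separated from the others. *)
Lemma splits_coprime (E : fieldType) d (p : {poly E}) rs :
  [pchar E] =i pred0 -> size p = d.+2 -> p`_d = 0 -> p != 'X^(d.+1) ->
  p = \prod_(r <- rs) ('X - r%:P) ->
  exists g h, [/\ [/\ g \is monic, h \is monic & coprimep g h],
     (size g < d.+2)%N, (size h < d.+2)%N & p = g * h].
Proof.
move=> char0 sp pd pX pE.
have srs : size rs = d.+1 by move: sp; rewrite pE size_prod_XsubC => -[].
pose r := head 0 rs.
have rrs : r \in rs by rewrite /r; case: rs srs {pE r} => //= *; rewrite mem_head.
have [rs_const|] := boolP (all (pred1 r) rs).
  have rsE : rs = nseq d.+1 r by rewrite -srs; apply/all_pred1P.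
  case/negP: pX; rewrite pE rsE big_nseq.
  have := @coefPn_prod_XsubC _ rs; rewrite srs -pE pd => /(_ isT)/eqP.
  rewrite rsE big_nseq iter_addr_0 eq_sym oppr_eq0 -mulr_natl mulf_eq0.
  rewrite (pcharf0P _).1 // => /= /eqP ->.
  by rewrite polyC0 subr0 iter_mulr mulr1 -exprS.
rewrite -has_predC => /hasP [s srs' /= sr].
exists (\prod_(x <- rs | x == r) ('X - x%:P)).
exists (\prod_(x <- rs | x != r) ('X - x%:P)).
have szf (Q : pred E) y : y \in rs -> ~~ Q y ->
   (size (\prod_(x <- rs | Q x) ('X - x%:P))%R < d.+2)%N.
  move=> yrs Qy; rewrite -big_filter size_prod_XsubC ltnS size_filter.
  rewrite -srs -(count_predC Q rs) -[X in (X < _)%N]addn0 ltn_add2l.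
  by rewrite -has_count; apply/hasP; exists y.
split; [split; rewrite ?monic_prod_XsubC //| | |].
- elim/big_ind: _ => [|x y|i /eqP ->]; first exact: coprime1p.
    by rewrite coprimepMl => -> ->.
  rewrite coprimep_sym coprimep_XsubC -big_filter root_prod_XsubC.
  by rewrite mem_filter eqxx.
- by apply: (szf _ s).
- by apply: (szf _ r) => //=; rewrite eqxx.
- by rewrite pE (bigID (pred1 r)).
Qed.

Section NewtonPuiseux.
Variables (E : fieldType) (psi : nat -> {rmorphism E -> E}).
Hypothesis char0 : [pchar E] =i pred0.
Hypothesis psiM : forall M N x,
  (0 < M)%N -> (0 < N)%N -> psi M (psi N x) = psi (M * N)%N x.
Hypothesis closedE : ram_closed psi.

Local Notation Psi := (fps_psi psi).
Local Notation PsiM := (fps_psiM psiM).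

(** After the substitution of t^N for t, where N = (d+1)! clears the denominators
    of all slopes ord(Q_j) / (d + 1 - j) of the Newton polygon, the smallest slope
    is an integer e. Dividing the roots by t^e then turns the coefficient where
    the smallest slope is attained into a unit, so that the reduction is not a
    power of X. *)
Lemma newton_rescaling d (Q : {poly fps E}) :
  Q \is monic -> size Q = d.+2 -> Q`_d = 0 -> Q != 'X^(d.+1) ->
  exists N e (B : {poly fps E}),
    [/\ (0 < N)%N,
        [/\ B \is monic, size B = d.+2 & B`_d = 0],
        forall j, (j < d.+1)%N ->
          (map_poly (Psi N) Q)`_j = tpow E e ^+ (d.+1 - j) * B`_j
      & forall M, map_poly (psi M) (map_poly (@residue E) B) != 'X^(d.+1)].
Proof.
move=> mQ sQ Qd QX; pose N := d.+1`!.
have [ord ordP] : exists ord : 'I_d.+1 -> nat, forall i : 'I_d.+1, Q`_i != 0 ->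
    fcoef Q`_i (ord i) != 0 /\ forall k, (k < ord i)%N -> fcoef Q`_i k = 0.
  suff /choice [ord ordP] : forall i : 'I_d.+1, exists o, Q`_i != 0 ->
    fcoef Q`_i o != 0 /\ forall k, (k < o)%N -> fcoef Q`_i k = 0 by exists ord.
  move=> i; have [Q0|] := eqVneq Q`_i 0; first by exists 0%N.
  move/fps_order => [o [g [g0 gE]]]; exists o => _; rewrite gE; split.
    by rewrite fcoef_tpowM ltnn subnn.
  by move=> k ko; rewrite fcoef_tpowM ko.
have [i0 Qi0] : exists i : 'I_d.+1, Q`_i != 0.
  apply: contrapT => nex; case/negP: QX; apply/eqP/polyP=> i; rewrite coefXn.
  case: (ltngtP i d.+1) => [id|di|->].
  - apply: contrapT => /eqP Qi; apply: nex; exists (Ordinal id) => //=.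
  - by rewrite nth_default // sQ.
  - by have := monicP mQ; rewrite lead_coefE sQ.
pose slope (i : 'I_d.+1) := (N %/ (d.+1 - i) * ord i)%N.
have slopeP i : (slope i * (d.+1 - i) = N * ord i)%N.
  rewrite /slope mulnAC divnK // dvdn_fact // subn_gt0 ltn_ord.
  by rewrite leq_subr.
case: (@arg_minnP _ i0 (fun i => Q`_i != 0) slope Qi0) => i1 Qi1 min_i1.
pose e := slope i1.
pose B := \poly_(j < d.+2)
   Fps (fun k => fcoef (Psi N Q`_j) (k + e * (d.+1 - j))%N).
have Qe j k : (j < d.+1)%N -> (k < e * (d.+1 - j))%N -> fcoef (Psi N Q`_j) k = 0.
  move=> jd ke; have [->|Qj] := eqVneq Q`_j 0; first by rewrite rmorph0 fcoef0.
  have [_ lowj] := ordP (Ordinal jd) Qj.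
  rewrite /=; case: ifP => // /dvdnP[m km].
  have N0 : (0 < N)%N by apply: fact_gt0.
  rewrite km mulnK // lowj ?rmorph0 //= -(ltn_pmul2r N0) -km.
  apply: leq_trans ke _; rewrite [(_ * N)%N]mulnC -slopeP leq_mul2r.
  by rewrite min_i1 ?orbT.
have B1 : B`_d.+1 = 1.
  rewrite coef_poly ltnSn; have := monicP mQ; rewrite lead_coefE sQ => ->.
  by apply/fpsP=> k; rewrite rmorph1 subnn muln0 /= addn0.
have sB : size B = d.+2 by rewrite size_poly_eq //; move: B1;
  rewrite coef_poly ltnSn => ->; rewrite oner_neq0.
exists N, e, B; split; first exact: fact_gt0.
- split=> //; first by rewrite monicE lead_coefE sB B1.
  rewrite coef_poly leqnSn Qd rmorph0.
  by apply/fpsP=> k; rewrite [LHS]fcoef0 fcoef0.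
- move=> j jd; rewrite coef_map /= coef_poly ltnS (ltnW jd).
  by rewrite -tpowM -tpow_divides // => k; apply: Qe.
move=> M; apply/eqP=> /polyP/(_ i1); rewrite coefXn !coef_map /=.
rewrite (ltn_eqF (ltn_ord i1)) => /eqP; rewrite fmorph_eq0.
rewrite coef_poly ltnS (ltnW (ltn_ord i1)) /residue /= add0n slopeP.
rewrite dvdn_mulr // mulKn ?fact_gt0 // fmorph_eq0.
by have [/negbTE -> _] := ordP i1 Qi1.
Qed.

(** Induction on the degree: translate to kill the subleading coefficient,
    rescale, and ramify until the reduction splits; it has a coprime
    factorization, which Hensel's lemma lifts to factors of smaller degree. *)
Theorem newton_puiseux : ram_closed Psi.
Proof.
move=> P mP; have [d] := ubnP (size P); elim: d P mP => // d IH P mP szP.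
have P0 := monic_neq0 mP.
case sP : (size P) => [|[|n]].
- by move/eqP: sP; rewrite size_poly_eq0 (negbTE P0).
- exists 1%N => //; exists [::]; rewrite big_nil.
  have /eqP/size_poly1P [c _ PE] := sP.
  by move: mP; rewrite PE monicE lead_coefC => /eqP ->; rewrite rmorph1.
have n0 : n.+1%:R != 0 :> E by rewrite (pcharf0P _).1.
pose c := fps_const (n.+1%:R^-1) * P`_n.
have [|mQ sQ Qn] := @shift_kills_subleading _ n P c mP sP.
  rewrite /c mulrA -(rmorph_nat (fps_const (A := E))) -rmorphM divff //.
  by rewrite rmorph1 mul1r.
apply: (ram_splits_shift (c := c)).
set Q := P \Po _ in mQ sQ Qn *.
have [->|QX] := eqVneq Q 'X^(n.+1).
  exists 1%N => //; rewrite map_polyXn; exists (nseq n.+1 0).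
  by rewrite big_nseq polyC0 subr0 iter_mulr mulr1.
have [N [e [B [N0 [mB sB Bn] QB nX]]]] := newton_rescaling mQ sQ Qn QX.
apply: (ram_splits_psi PsiM N0).
apply: (ram_splits_scale (d := n.+1) (c := tpow E e) (q := B)) => //.
- by rewrite monic_map.
- by rewrite size_map_poly_id0 // (monicP mQ) rmorph1 oner_neq0.
pose b := map_poly (@residue E) B.
have mb : b \is monic by rewrite monic_map.
have sb : size b = n.+2 by rewrite size_map_poly_id0 // (monicP mB) rmorph1 oner_neq0.
have [M M0 [rs rsE]] := closedE mb.
have [|||g [h [[mg mh cop] sg sh ghE]]] := splits_coprime (d := n) char0 _ _ _ rsE.
- by rewrite size_map_poly.
- by rewrite !coef_map /= Bn !rmorph0.
- exact: nX.
apply: (ram_splits_psi PsiM M0).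
have [||G [H [mG mH sG sH ->]]] := @hensel E (map_poly (Psi M) B) g h _ mg mh cop.
- by rewrite monic_map.
- rewrite -ghE -!map_poly_comp; apply: eq_map_poly => f /=.
  by rewrite /residue /= dvdn0 div0n.
apply: (ram_splitsM PsiM); apply: IH => //.
  by rewrite sG; apply: leq_trans sg _; rewrite -sP -ltnS.
by rewrite sH; apply: leq_trans sh _; rewrite -sP -ltnS.
Qed.

End NewtonPuiseux.

(** * Fraction fields: extending morphisms and derivations *)

Local Notation "x %:F" := (@FracField.tofrac _ x).

Lemma frac_decomp (A : idomainType) (x : {fraction A}) :
  exists ab : A * A, ab.2 != 0 /\ x = ab.1%:F / ab.2%:F.
Proof.
elim/quotW: x => r; exists (frac r); split; first exact: denom_ratioP.
apply: (canRL (mulfK _)); first by rewrite tofrac_eq0 denom_ratioP.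
unlock FracField.tofrac; rewrite -[LHS]FracField.pi_mul; apply/eqmodP.
rewrite /= FracField.equivfE /FracField.mulf !numden_Ratio ?mulr1 ?denom_ratioP ?oner_eq0 //.
by rewrite mulrC.
Qed.

Definition numden (A : idomainType) (x : {fraction A}) : A * A :=
  projT1 (cid (frac_decomp x)).

Lemma numdenP (A : idomainType) (x : {fraction A}) :
  (numden x).2 != 0 /\ x = (numden x).1%:F / (numden x).2%:F.
Proof. exact: projT2 (cid (frac_decomp x)). Qed.

Lemma frac_eq (A : idomainType) (a b c d : A) : b != 0 -> d != 0 ->
  a%:F / b%:F = c%:F / d%:F -> a * d = c * b.
Proof.
move=> b0 d0 /eqP; rewrite eqr_div ?tofrac_eq0 // -!tofracM tofrac_eq.
by move/eqP.
Qed.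

Section QuotientIdentities.
Variable F : fieldType.
Implicit Types a b c d x y : F.

Lemma sub_fractions a b c d : b != 0 -> d != 0 ->
  a / b - c / d = (a * d - c * b) / (b * d).
Proof. by move=> b0 d0; field; rewrite b0 d0. Qed.

Lemma quotient_rule_add a b c d a' b' c' d' : b != 0 -> d != 0 ->
  (((a' * d + a * d') + (c' * b + c * b')) * (b * d)
      - (a * d + c * b) * (b' * d + b * d')) / (b * d) ^+ 2
  = (a' * b - a * b') / b ^+ 2 + (c' * d - c * d') / d ^+ 2.
Proof. by move=> b0 d0; field; rewrite b0 d0. Qed.

Lemma quotient_rule_mul a b c d a' b' c' d' : b != 0 -> d != 0 ->
  ((a' * c + a * c') * (b * d) - (a * c) * (b' * d + b * d')) / (b * d) ^+ 2
  = (a' * b - a * b') / b ^+ 2 * (c / d)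
    + a / b * ((c' * d - c * d') / d ^+ 2).
Proof. by move=> b0 d0; field; rewrite b0 d0. Qed.

Lemma mul_scaled c x k : (0 < k)%N -> c != 0 ->
  c^-1 ^+ k * (c ^+ k.-1 * (c * x)) = x.
Proof.
by case: k => // k _ c0; rewrite exprVn /= [_ * (c * x)]mulrA -exprSr mulKf ?expf_neq0.
Qed.

End QuotientIdentities.

(** A function is extended to fractions through a chosen representative; its
    value does not depend on the choice ([frac_mapE]). *)
Section FracMap.
Variables (A : idomainType) (F : fieldType) (f : {rmorphism A -> F}).
Hypothesis f_inj : injective f.

Definition frac_map of injective f := fun x : {fraction A} =>
  f (numden x).1 / f (numden x).2.

Local Notation fm := (frac_map f_inj).

Lemma inj_neq0 a : a != 0 -> f a != 0.
Proof. by apply: contra_neq => fa; apply: f_inj; rewrite fa rmorph0. Qed.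

Lemma frac_mapE a b : b != 0 -> fm (a%:F / b%:F) = f a / f b.
Proof.
move=> b0; rewrite /frac_map; have [d0 /(frac_eq b0 d0)] := numdenP (a%:F / b%:F).
move=> e; apply/eqP; rewrite eqr_div ?inj_neq0 // -!rmorphM e.
by [].
Qed.

Lemma frac_mapF a : fm a%:F = f a.
Proof.
by have := frac_mapE a (oner_neq0 A); rewrite tofrac1 rmorph1 !divr1.
Qed.

Fact frac_map_additive : additive fm.
Proof.
move=> x y; have [[a b] /= [b0 ->]] := frac_decomp x.
have [[c d] /= [d0 ->]] := frac_decomp y.
have -> : a%:F / b%:F - c%:F / d%:F = (a * d - c * b)%:F / (b * d)%:F.
  by rewrite tofracB !tofracM sub_fractions ?tofrac_eq0.
by rewrite !frac_mapE ?mulf_neq0 // rmorphB !rmorphM sub_fractions ?inj_neq0.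
Qed.

Fact frac_map_multiplicative : multiplicative fm.
Proof.
split=> [x y|]; last by rewrite -tofrac1 frac_mapF rmorph1.
have [[a b] /= [b0 ->]] := frac_decomp x.
have [[c d] /= [d0 ->]] := frac_decomp y.
by rewrite mulf_div -!tofracM !frac_mapE ?mulf_neq0 // !rmorphM mulf_div.
Qed.

HB.instance Definition _ := GRing.isAdditive.Build {fraction A} F
  (frac_map f_inj) frac_map_additive.
HB.instance Definition _ := GRing.isMultiplicative.Build {fraction A} F
  (frac_map f_inj) frac_map_multiplicative.

End FracMap.

Section FracRam.
Variables (A : idomainType) (psi : nat -> {rmorphism A -> A}).
Hypothesis psiM : forall M N x,
  (0 < M)%N -> (0 < N)%N -> psi M (psi N x) = psi (M * N)%N x.
Hypothesis psi_inj : forall N, injective (psi N.+1).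

Local Notation iota := (@FracField.tofrac A).

Fact tofrac_psi_inj N : injective (iota \o psi N.+1).
Proof.
by move=> x y /eqP /=; rewrite tofrac_eq => /eqP /psi_inj.
Qed.

(** Only positive indices are ramifications; [psi 0] need not be injective,
    so the index 0 is given the identity. *)
Definition frac_psi N : {rmorphism {fraction A} -> {fraction A}} :=
  if N is N'.+1 then frac_map (@tofrac_psi_inj N') else idfun.

Lemma frac_psiF N a : (0 < N)%N -> frac_psi N a%:F = (psi N a)%:F.
Proof. by case: N => // N _; exact: (frac_mapF (@tofrac_psi_inj N) a). Qed.

Lemma frac_psiM M N x : (0 < M)%N -> (0 < N)%N ->
  frac_psi M (frac_psi N x) = frac_psi (M * N)%N x.
Proof.
move=> M0 N0; have [[a b] /= [b0 ->]] := frac_decomp x.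
by rewrite !fmorph_div !frac_psiF ?psiM ?muln_gt0 ?M0.
Qed.

(** Clearing denominators and rescaling the variable makes a monic polynomial
    over the fraction field integral. *)
Lemma ram_closed_frac : ram_closed psi -> ram_closed frac_psi.
Proof.
move=> closedA p mp; case sp : (size p) => [|d].
  by move/eqP: sp; rewrite size_poly_eq0 (negbTE (monic_neq0 mp)).
pose b := \prod_(j < d) (numden p`_j).2.
have b0 : b != 0 by apply/prodf_neq0 => j _; have [] := numdenP p`_j.
have int j : (j < d)%N -> exists a, a%:F = b%:F * p`_j.
  move=> jd; have [d0 pj] := numdenP p`_j.
  exists ((numden p`_j).1 * \prod_(i < d | i != Ordinal jd) (numden p`_i).2).
  have -> : b = (numden p`_j).2 * \prod_(i < d | i != Ordinal jd) (numden p`_i).2.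
    by rewrite /b (bigD1 (Ordinal jd)).
  move: d0 pj; case: (numden p`_j) => x y /= y0 ->; rewrite !tofracM.
  by rewrite [y%:F * _]mulrC mulrACA divff ?mulr1 ?tofrac_eq0 // mulrC.
have [num numP] : exists num : nat -> A,
    forall j, (j < d)%N -> (num j)%:F = b%:F * p`_j.
  suff /choice [num numP] : forall j, exists a, (j < d)%N -> a%:F = b%:F * p`_j.
    by exists num.
  move=> j; case: (ltnP j d) => [/int [a aE]|_]; last by exists 0.
  by exists a.
pose q := \poly_(j < d.+1) if (j < d)%N then b ^+ (d - j).-1 * num j else 1.
have q1 : q`_d = 1 by rewrite coef_poly ltnSn ltnn.
have sq : size q = d.+1 by rewrite size_poly_eq // ltnn oner_neq0.
have mq : q \is monic by rewrite monicE lead_coefE sq q1.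
have [N N0 spl] := closedA q mq.
apply: (@ram_splits_scale _ frac_psi d (b%:F^-1) p (map_poly iota q) mp sp).
- by rewrite monic_map.
- by rewrite size_map_poly_id0 // (monicP mq) rmorph1 oner_neq0.
- move=> j jd; rewrite coef_map /= coef_poly ltnS (ltnW jd) jd.
  by rewrite tofracM numP // tofracXn mul_scaled ?subn_gt0 ?tofrac_eq0.
exists N => //; have -> : map_poly (frac_psi N) (map_poly iota q)
    = map_poly iota (map_poly (psi N) q).
  by apply/polyP=> i; rewrite !coef_map /= frac_psiF.
exact: splits_map.
Qed.

End FracRam.

Definition is_derivation (A : comNzRingType) (D : A -> A) :=
  {morph D : x y / x + y} /\ forall x y, D (x * y) = D x * y + x * D y.

Section Derivation.
Variables (A : comNzRingType) (D : A -> A).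
Hypothesis derD : is_derivation D.

Lemma derD_add x y : D (x + y) = D x + D y. Proof. exact: derD.1. Qed.
Lemma derD_mul x y : D (x * y) = D x * y + x * D y. Proof. exact: derD.2. Qed.

Lemma derD0 : D 0 = 0.
Proof. by apply: (addrI (D 0)); rewrite -derD_add !addr0. Qed.

Lemma derDN x : D (- x) = - D x.
Proof. by apply: (addrI (D x)); rewrite -derD_add !subrr derD0. Qed.

Lemma derDB x y : D (x - y) = D x - D y.
Proof. by rewrite derD_add derDN. Qed.

Lemma derD1 : D 1 = 0.
Proof.
by apply: (addrI (D 1)); rewrite addr0 -{3}[1]mulr1 derD_mul mulr1 mul1r.
Qed.

Lemma derD_sum I (r : seq I) (Q : pred I) (F : I -> A) :
  D (\sum_(i <- r | Q i) F i) = \sum_(i <- r | Q i) D (F i).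
Proof. by elim/big_rec2: _ => [|i y x _ <-]; rewrite ?derD0 ?derD_add. Qed.

Lemma derD_horner (p : {poly A}) z :
  D p.[z] = (map_poly D p).[z] + p^`().[z] * D z.
Proof.
elim/poly_ind: p => [|p c IH].
  by rewrite /map_poly size_poly0 poly_def big_ord0 deriv0 !horner0 derD0 mul0r addr0.
have -> : map_poly D (p * 'X + c%:P) = map_poly D p * 'X + (D c)%:P.
  apply/polyP=> i; rewrite coef_map_id0 ?derD0 // !coefD !coefMX !coefC derD_add.
  by case: i => [|i] /=; rewrite ?derD0 ?coef_map_id0 ?derD0 ?addr0 ?add0r.
rewrite derivD derivM derivX derivC mulr1 addr0 !hornerE derD_add derD_mul IH.
by ring.
Qed.

End Derivation.

Section FracDerivation.
Variables (A : idomainType) (D : A -> A).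
Hypothesis derD : is_derivation D.

Definition frac_der (x : {fraction A}) : {fraction A} :=
  let: (a, b) := numden x in (D a * b - a * D b)%:F / (b ^+ 2)%:F.

Lemma frac_derE a b : b != 0 ->
  frac_der (a%:F / b%:F) = (D a * b - a * D b)%:F / (b ^+ 2)%:F.
Proof.
move=> b0; rewrite /frac_der.
have [] := numdenP (a%:F / b%:F); case: (numden _) => c d /= d0.
move/(frac_eq b0 d0) => e; apply/eqP.
rewrite eqr_div ?tofrac_eq0 ?expf_neq0 // -!tofracM tofrac_eq.
have := congr1 D e; rewrite !(derD_mul derD) => e'.
rewrite -subr_eq0; apply/eqP.
have -> : (D c * d - c * D d) * b ^+ 2 - (D a * b - a * D b) * d ^+ 2
  = b * d * ((D c * b + c * D b) - (D a * d + a * D d))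
    + (a * d - c * b) * (d * D b + b * D d) by ring.
by rewrite e' e !subrr mulr0 mul0r addr0.
Qed.

Lemma frac_derF a : frac_der a%:F = (D a)%:F.
Proof.
have := frac_derE a (oner_neq0 A).
by rewrite (derD1 derD) tofrac1 divr1 expr1n tofrac1 divr1 mulr0 subr0 mulr1.
Qed.

Lemma frac_der_is_derivation : is_derivation frac_der.
Proof.
split=> x y; have [[a b] /= [b0 ->]] := frac_decomp x;
  have [[c d] /= [d0 ->]] := frac_decomp y.
- rewrite addf_div ?tofrac_eq0 // -!tofracM -tofracD.
  rewrite !frac_derE ?mulf_neq0 // (derD_add derD) !(derD_mul derD).
  rewrite !(tofracB, tofracM, tofracXn, tofracD).
  by rewrite quotient_rule_add ?tofrac_eq0.
rewrite mulf_div -!tofracM !frac_derE ?mulf_neq0 // !(derD_mul derD).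
rewrite !(tofracB, tofracM, tofracXn, tofracD).
by rewrite quotient_rule_mul ?tofrac_eq0.
Qed.

End FracDerivation.

(** * Monomial curves *)

Section WeightedDegree.
Variable n : nat.
Implicit Types (w : 'I_n -> nat) (m : 'X_{1..n}).

Definition wdeg w m := (\sum_(i < n) w i * m i)%N.

Lemma mdeg_le_wdeg w m : (forall i, 0 < w i)%N -> (mdeg m <= wdeg w m)%N.
Proof.
move=> w0; rewrite mdegE; apply: leq_sum => i _.
by rewrite leq_pmull.
Qed.

Lemma wdegZ N w m : wdeg (fun i => N * w i)%N m = (N * wdeg w m)%N.
Proof. by rewrite /wdeg big_distrr; apply: eq_bigr => i _; rewrite /= mulnA. Qed.

(** The bound of a bounded-degree index type is immaterial in a sum over the
    exponents of one weighted degree. *)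
Lemma sum_wdeg (V : nmodType) w k b b' (G : 'X_{1..n} -> V) :
  (forall i, 0 < w i)%N -> (k < b)%N -> (k < b')%N ->
  \sum_(m : 'X_{1..n < b} | wdeg w m == k) G m
    = \sum_(m : 'X_{1..n < b'} | wdeg w m == k) G m.
Proof.
move=> w0.
pose l c := [seq m <- [seq val m | m : 'X_{1..n < c}] | wdeg w m == k].
have lE c : \sum_(m : 'X_{1..n < c} | wdeg w m == k) G m = \sum_(m <- l c) G m.
  by rewrite /l big_filter big_map big_enum_cond; apply: eq_bigl => m; rewrite inE.
have meml c m : (k < c)%N -> (m \in l c) = (wdeg w m == k).
  move=> kc; rewrite mem_filter; case: eqP => //= wm.
  have mc : (mdeg m < c)%N by apply: leq_ltn_trans kc; rewrite -wm mdeg_le_wdeg.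
  by apply/mapP; exists (BMultinom mc); rewrite ?mem_enum.
move=> kb kb'; rewrite !lE; apply: perm_big; apply: uniq_perm.
- by rewrite filter_uniq // map_inj_uniq ?enum_uniq //; apply: val_inj.
- by rewrite filter_uniq // map_inj_uniq ?enum_uniq //; apply: val_inj.
by move=> m; rewrite !meml.
Qed.

End WeightedDegree.

Section Curve.
Variables (n : nat) (K : comNzRingType) (E : comNzRingType).
Variables (iota : {rmorphism K -> E}) (u : 'I_n -> E) (w : 'I_n -> nat).
Hypothesis w_gt0 : forall i, (0 < w i)%N.
Local Notation R := (mseries n K).
Implicit Types (f g : R).

(** The substitution X_i := u_i t^(w_i); positivity of the weights makes each
    coefficient a finite sum. *)
Definition curve of (forall i, (0 < w i)%N) := fun f : R =>
  Fps (fun k => \sum_(m : 'X_{1..n < k.+1} | wdeg w m == k)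
                  iota (scoef f m) * mmap1 u m).

Local Notation phi := (curve w_gt0).

Lemma fcoef_curve b f k : (k < b)%N ->
  fcoef (phi f) k
    = \sum_(m : 'X_{1..n < b} | wdeg w m == k) iota (scoef f m) * mmap1 u m.
Proof. exact: (sum_wdeg (fun m => iota (scoef f m) * mmap1 u m)). Qed.

Fact curve_additive : additive phi.
Proof.
move=> f g; apply/fpsP=> k; rewrite fcoefB /= -sumrB.
by apply: eq_bigr => m _; rewrite rmorphB mulrBl.
Qed.

(* To any given order in t the curve is a substitution into polynomials, which
   is multiplicative. *)
Let h i : {poly E} := u i *: 'X^(w i).
Let poly_curve (p : {mpoly K[n]}) : {poly E} := mmap (polyC \o iota) h p.

Lemma mmap1_curve m : mmap1 h m = mmap1 u m *: 'X^(wdeg w m).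
Proof.
rewrite /mmap1 /wdeg; elim/big_rec3: _ => [|i x y z _ ->].
  by rewrite expr0 scale1r.
by rewrite exprZn -exprM -scalerAl -scalerAr scalerA exprD.
Qed.

Lemma coef_poly_curve p k :
  (poly_curve p)`_k = \sum_(m <- msupp p | wdeg w m == k) iota p@_m * mmap1 u m.
Proof.
rewrite /poly_curve /mmap coef_sum [RHS]big_mkcond; apply: eq_bigr => m _ /=.
rewrite mmap1_curve mul_polyC !coefZ coefXn eq_sym.
by case: eqP; rewrite ?mulr1 ?mulr0.
Qed.

Lemma poly_curve_eq p q k :
  (forall m, (mdeg m <= k)%N -> p@_m = q@_m) ->
  (poly_curve p)`_k = (poly_curve q)`_k.
Proof.
move=> pq; apply/eqP; rewrite -subr_eq0 -coefB.
have -> : poly_curve p - poly_curve q = poly_curve (p - q).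
  by rewrite /poly_curve rmorphB.
rewrite coef_poly_curve big1 // => m /eqP mk.
by rewrite mcoeffB pq ?subrr ?rmorph0 ?mul0r // -mk mdeg_le_wdeg.
Qed.

Lemma fcoef_curve_trunc b f k : (k < b)%N ->
  fcoef (phi f) k = (poly_curve (mseries_trunc b f))`_k.
Proof.
move=> kb; rewrite (fcoef_curve _ kb) /poly_curve /mseries_trunc rmorph_sum.
rewrite coef_sum [LHS]big_mkcond; apply: eq_bigr => m _ /=.
rewrite mmapZ mmapX mmap1_curve mul_polyC !coefZ coefXn eq_sym.
by case: eqP; rewrite ?mulr1 ?mulr0.
Qed.

Fact curve_multiplicative : multiplicative phi.
Proof.
split=> [f g|]; apply/fpsP=> k; last first.
  rewrite (fcoef_curve_trunc _ (ltnSn k)) (@poly_curve_eq _ 1).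
    by rewrite /poly_curve rmorph1 coef1 fcoef1.
  by move=> m mk; rewrite mcoeff_trunc // mcoeff1.
rewrite (fcoef_curve_trunc _ (ltnSn k)).
have := @fcoefM_trunc _ k.+1 (phi f) (phi g) k (ltnSn k).
rewrite -[fps_mul _ _]/(phi f * phi g) => ->.
transitivity ((poly_curve (mseries_trunc k.+1 f * mseries_trunc k.+1 g))`_k).
  apply: poly_curve_eq => m mk; rewrite mcoeff_trunc //.
  by apply: scoefM.
rewrite /poly_curve rmorphM; apply: coefM_local => i ik.
  by rewrite coef_trunc // (@fcoef_curve_trunc k.+1).
by rewrite coef_trunc // (@fcoef_curve_trunc k.+1).
Qed.

HB.instance Definition _ := GRing.isAdditive.Build R (fps E)
  (curve w_gt0) curve_additive.
HB.instance Definition _ := GRing.isMultiplicative.Build R (fps E)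
  (curve w_gt0) curve_multiplicative.

Lemma residue_curve f : residue (phi f) = iota (scoef f 0%MM).
Proof.
have h0 : (mdeg (0%MM : 'X_{1..n}) < 1)%N by rewrite mdeg0.
rewrite /residue /= (bigD1 (BMultinom h0)) /=; last first.
  by rewrite /wdeg big1 // => i _; rewrite mnm0E muln0.
rewrite mmap11 mulr1 big1 ?addr0 // => m /andP[_]; rewrite -val_eqE /=.
by have := bmdeg m; rewrite ltnS leqn0 mdeg_eq0 => ->.
Qed.

Lemma curve_monom a :
  phi (mseries_monom K a) = fps_const (mmap1 u a) * tpow E (wdeg w a).
Proof.
apply/fpsP=> k; rewrite fcoef_constM /=; case: eqP => [->|ka].
  have ab : (mdeg a < (wdeg w a).+1)%N by rewrite ltnS mdeg_le_wdeg.
  rewrite (bigD1 (BMultinom ab)) //= eqxx rmorph1 mul1r big1 ?addr0 ?mulr1 //.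
  move=> m /andP[_]; rewrite -val_eqE /= => /negbTE ->.
  by rewrite rmorph0 mul0r.
rewrite mulr0 big1 // => m /eqP mk; case: eqP => [ma|_].
  by case: ka; rewrite -mk ma.
by rewrite rmorph0 mul0r.
Qed.

End Curve.

Arguments curve [n K E] iota u [w] w_gt0.
Arguments fcoef_curve [n K E] iota u [w] w_gt0 [b] f [k].

Lemma scale_gt0 n N (w : 'I_n -> nat) :
  (0 < N)%N -> (forall i, 0 < w i)%N -> forall i, (0 < N * w i)%N.
Proof. by move=> N0 w0 i; rewrite muln_gt0 N0 w0. Qed.

Lemma fps_psi_curve n (K E : comNzRingType) (iota : {rmorphism K -> E})
    (u : 'I_n -> E) w (w0 : forall i, (0 < w i)%N)
    (psi : nat -> {rmorphism E -> E}) N (N0 : (0 < N)%N) (f : mseries n K) :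
  (forall c, psi N (iota c) = iota c) ->
  fps_psi psi N (curve iota u w0 f)
    = curve iota (fun i => psi N (u i)) (scale_gt0 N0 w0) f.
Proof.
move=> psi_iota; apply/fpsP=> k.
rewrite (fcoef_curve _ _ (scale_gt0 N0 w0) f (ltnSn k)) [LHS]/=.
rewrite [RHS](eq_bigl (fun m : 'X_{1..n < k.+1} => (N * wdeg w m)%N == k)); last first.
  by move=> m; rewrite wdegZ.
case: ifP => [/dvdnP[m ->]|/negbT Nk]; last first.
  rewrite big1 // => m /eqP mk; case/negP: Nk; rewrite -mk.
  exact: dvdn_mulr.
rewrite mulnK // -[\sum_(_ | _) _]/(fcoef (curve iota u w0 f) m).
rewrite (fcoef_curve _ _ w0 f (b := (m * N).+1)) ?ltnS ?leq_pmulr // rmorph_sum.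
apply: eq_big => [i|i _]; first by rewrite -(eqn_pmul2l N0) [X in _ == X]mulnC.
rewrite rmorphM psi_iota; congr (_ * _); rewrite rmorph_prod.
by apply: eq_bigr => j _; rewrite rmorphXn.
Qed.

(** * Test curves on which a polynomial splits *)

Section FpsDerivations.
Variable A : comNzRingType.

Definition theta (f : fps A) : fps A := Fps (fun k => k%:R * fcoef f k).

Lemma fcoef_theta f k : fcoef (theta f) k = k%:R * fcoef f k.
Proof. by []. Qed.

Lemma theta_is_derivation : is_derivation theta.
Proof.
split=> f g; apply/fpsP=> k; first by rewrite /= mulrDr.
rewrite fcoefD [LHS]/= !fcoefM -big_split mulr_sumr; apply: eq_bigr => i _ /=.
have ik : (i <= k)%N by rewrite -ltnS.
by rewrite -{1}(subnKC ik) natrD; ring.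
Qed.

Lemma theta_tpow c m : theta (fps_const c * tpow A m) =
  m%:R * (fps_const c * tpow A m).
Proof.
apply/fpsP=> k; rewrite -(rmorph_nat (fps_const (A := A))) fcoef_theta.
by rewrite !fcoef_constM /=; case: eqP => [->|_] //; rewrite !mulr0.
Qed.

Definition fps_der (D : A -> A) (f : fps A) : fps A :=
  Fps (fun k => D (fcoef f k)).

Lemma fps_der_is_derivation D : is_derivation D -> is_derivation (fps_der D).
Proof.
move=> derD; split=> f g; apply/fpsP=> k; first by rewrite /= (derD_add derD).
rewrite fcoefD [LHS]/= !fcoefM -big_split (derD_sum derD).
by apply: eq_bigr => i _; rewrite (derD_mul derD).
Qed.

Lemma scale_is_derivation (D : A -> A) c :
  is_derivation D -> is_derivation (fun x => c * D x).
Proof.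
move=> derD; split=> x y; rewrite ?(derD_add derD) ?(derD_mul derD) ?mulrDr //.
by congr (_ + _); ring.
Qed.

End FpsDerivations.

Section Laurent.
Variable K : closedFieldType.
Hypothesis charK0 : [pchar K] =i pred0.

Definition laurent : fieldType := {fraction fps K}.

Definition cst : {rmorphism K -> laurent} :=
  (@FracField.tofrac (fps K)) \o (@fps_const K).
Definition spow m : laurent := (tpow K m)%:F.

(** An algebraically closed field needs no ramification. *)
Definition triv_psi (N : nat) : {rmorphism K -> K} := idfun.

Lemma triv_psi_closed : ram_closed triv_psi.
Proof.
move=> p mp; exists 1%N => //; have [rs rsE] := closed_field_poly_normal p.
exists rs; rewrite map_poly_id //.
by rewrite rsE (monicP mp) scale1r.
Qed.

Lemma fram_inj (E : fieldType) N (f : {rmorphism E -> E}) : (0 < N)%N ->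
  injective (fram N f).
Proof.
move=> N0 g h /fpsP gh; apply/fpsP=> k; have := gh (k * N)%N.
by rewrite /= dvdn_mull // mulnK // => /fmorph_inj.
Qed.

Lemma triv_psi_inj N : injective (fps_psi triv_psi N.+1).
Proof. exact: fram_inj. Qed.

Definition laurent_psi : nat -> {rmorphism laurent -> laurent} :=
  frac_psi triv_psi_inj.

Lemma laurent_psiM M N x : (0 < M)%N -> (0 < N)%N ->
  laurent_psi M (laurent_psi N x) = laurent_psi (M * N)%N x.
Proof. by apply: frac_psiM; apply: fps_psiM. Qed.

Lemma laurent_char0 : [pchar laurent] =i pred0.
Proof. by move=> p; rewrite (fmorph_pchar cst) charK0. Qed.

Lemma laurent_psi_closed : ram_closed laurent_psi.
Proof.
apply: ram_closed_frac; apply: newton_puiseux => //; exact: triv_psi_closed.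
Qed.

Lemma laurent_psi_cst N c : (0 < N)%N -> laurent_psi N (cst c) = cst c.
Proof.
move=> N0; rewrite /laurent_psi /cst /= frac_psiF //; congr (_%:F).
apply/fpsP=> k /=; case: k => [|k]; first by rewrite dvdn0 div0n.
case: ifP => // /dvdnP[[|m] km] //; rewrite km mulnK //.
Qed.

Lemma laurent_psi_spow N m : (0 < N)%N -> laurent_psi N (spow m) = spow (N * m)%N.
Proof.
move=> N0; rewrite /laurent_psi /spow frac_psiF //; congr (_%:F).
apply/fpsP=> k /=; case: ifP => [/dvdnP[j ->]|/negP Nk].
  by rewrite mulnK // mulnC eqn_pmul2l.
by case: eqP => // km; case: Nk; rewrite km dvdn_mulr.
Qed.

Definition ltheta : laurent -> laurent := frac_der (@theta K).

Lemma ltheta_is_derivation : is_derivation ltheta.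
Proof. exact: frac_der_is_derivation (@theta_is_derivation K). Qed.

Lemma ltheta_spow c m : ltheta (cst c * spow m) = m%:R * (cst c * spow m).
Proof.
rewrite /ltheta /cst /spow /= -tofracM (frac_derF (@theta_is_derivation K)).
rewrite theta_tpow [LHS]tofracM; congr (_ * _).
exact: (rmorph_nat (@FracField.tofrac (fps K))).
Qed.

Lemma ltheta_cst c : ltheta (cst c) = 0.
Proof. by have := ltheta_spow c 0; rewrite /spow tpow0 tofrac1 mulr1 mul0r. Qed.

(** After the ramification of index N, the derivation with the right eigenvalues
    on the ramified monomials s^(N k) is s d/ds divided by N. *)
Definition ram_theta (N : nat) (x : laurent) : laurent :=
  cst (N%:R^-1) * ltheta x.

Lemma ram_theta_is_derivation N : is_derivation (ram_theta N).
Proof. by apply: scale_is_derivation; apply: ltheta_is_derivation. Qed.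

Section TestCurve.
Variables (n : nat) (mu w : 'I_n -> nat).
Hypothesis w_gt0 : forall i, (0 < w i)%N.
Variables (N : nat) (N_gt0 : (0 < N)%N).

Definition test_curve : {rmorphism mseries n K -> fps laurent} :=
  curve cst (fun i => spow (N * mu i)%N) (scale_gt0 N_gt0 w_gt0).

Lemma mmap1_spow m : mmap1 (fun i => spow (N * mu i)%N) m = spow (N * wdeg mu m)%N.
Proof.
rewrite /mmap1 /wdeg big_distrr /=.
elim/big_rec2: _ => [|i x y _ ->]; first by rewrite /spow tpow0 tofrac1.
by rewrite /spow tpowD -tofracXn -tpowM tofracM mulnA.
Qed.

(** X_i d/dX_i acts on a monomial through its exponents; [mu] combines these
    derivations so that substitution carries them to s d/ds. *)
Definition mseries_der (f : mseries n K) : mseries n K :=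
  MSeries (fun m => (wdeg mu m)%:R * scoef f m).

Lemma fcoef_fps_ram_theta g k :
  fcoef (fps_der (ram_theta N) g) k = cst (N%:R^-1) * ltheta (fcoef g k).
Proof. by []. Qed.

Lemma fcoef_test_curve b f k : (k < b)%N ->
  fcoef (test_curve f) k = \sum_(m : 'X_{1..n < b} | (N * wdeg w m == k)%N)
      cst (scoef f m) * spow (N * wdeg mu m)%N.
Proof.
move=> kb; apply: etrans (fcoef_curve _ _ (scale_gt0 N_gt0 w_gt0) f kb) _.
by apply: eq_big => m *; rewrite ?wdegZ ?mmap1_spow.
Qed.

Lemma ram_theta_test_curve f :
  fps_der (ram_theta N) (test_curve f) = test_curve (mseries_der f).
Proof.
have N0 : N%:R != 0 :> K by rewrite (pcharf0P _).1 // -lt0n.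
apply/fpsP=> k; rewrite fcoef_fps_ram_theta !(fcoef_test_curve _ (ltnSn k)).
rewrite (derD_sum ltheta_is_derivation) mulr_sumr; apply: eq_bigr => m _.
rewrite ltheta_spow !mulrA; congr (_ * _).
rewrite -(rmorph_nat cst) -!rmorphM; congr (cst _).
by rewrite natrM mulrA mulVf // mul1r.
Qed.

End TestCurve.

(** Newton-Puiseux over K makes the field of Laurent series in s closed up to
    ramification; applied once more, over that field, it splits the image of P
    on the curve X_i = s^(mu_i) t^(w_i), and ramifying the curve is the same as
    multiplying all mu_i and w_i by N. *)
Lemma test_curve_splits n (mu w : 'I_n -> nat) (w0 : forall i, (0 < w i)%N)
    (P : {poly mseries n K}) : P \is monic ->
  exists N (N0 : (0 < N)%N), splits (map_poly (test_curve mu w0 N0) P).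
Proof.
move=> mP; pose phi := curve cst (fun i => spow (mu i)) w0.
have psiM : forall M N x, (0 < M)%N -> (0 < N)%N ->
   laurent_psi M (laurent_psi N x) = laurent_psi (M * N)%N x.
  by move=> *; rewrite laurent_psiM.
have mphi : map_poly phi P \is monic by rewrite monic_map.
have [N N0] := newton_puiseux laurent_char0 psiM laurent_psi_closed mphi.
move=> spl; exists N, N0; suff -> : map_poly (test_curve mu w0 N0) P
  = map_poly (fps_psi laurent_psi N) (map_poly phi P) by [].
apply/polyP=> j; rewrite !coef_map /=.
apply: etrans (esym (fps_psi_curve _ w0 N0 P`_j _)); last first.
  by move=> c; apply: laurent_psi_cst.
apply/fpsP=> k; rewrite (fcoef_test_curve _ _ _ _ (ltnSn k)).
rewrite (fcoef_curve _ _ _ _ (ltnSn k)).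
apply: eq_big => m; first by rewrite wdegZ.
move=> _; congr (_ * _); rewrite -mmap1_spow /mmap1.
by apply: eq_bigr => i _; rewrite laurent_psi_spow.
Qed.

End Laurent.

(** * Weights and vertices of sets of exponents *)

Lemma digits_inj n b (f g : 'I_n -> nat) :
  (forall i, f i < b)%N -> (forall i, g i < b)%N ->
  (\sum_(i < n) b ^ i * f i = \sum_(i < n) b ^ i * g i)%N -> f =1 g.
Proof.
elim: n f g => [|n IH] f g fb gb; first by move=> _ [].
have shift (h : 'I_n.+1 -> nat) : (\sum_(i < n.+1) b ^ i * h i =
    h ord0 + b * \sum_(i < n) b ^ i * h (lift ord0 i))%N.
  rewrite big_ord_recl mul1n big_distrr; congr (_ + _)%N.
  by apply: eq_bigr => i _; rewrite /= /bump add1n expnS mulnA.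
have b0 : (0 < b)%N by apply: leq_ltn_trans (fb ord0).
rewrite !shift => e.
have e0 : f ord0 = g ord0.
  have := congr1 (modn ^~ b) e.
  by rewrite ![(_ + b * _)%N]addnC ![(b * _)%N]mulnC !modnMDl !modn_small.
have : (b * \sum_(i < n) b ^ i * f (lift ord0 i)
        = b * \sum_(i < n) b ^ i * g (lift ord0 i))%N.
  by move: e; rewrite e0 => /addnI.
move/eqP; rewrite eqn_pmul2l // => /eqP.
move/(IH (fun i => f (lift ord0 i)) (fun i => g (lift ord0 i))) => IH'.
move=> i; case: (unliftP ord0 i) => [j ->|-> //].
exact: IH'.
Qed.

(** Exponents of bounded degree are determined by their digits in a large base. *)
Lemma separating_weight n b : exists2 w : 'I_n -> nat, (forall i, 0 < w i)%N &
  forall m m' : 'X_{1..n}, (mdeg m < b)%N -> (mdeg m' < b)%N ->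
    wdeg w m = wdeg w m' -> m = m'.
Proof.
exists (fun i => b.+1 ^ i)%N => [i|m m' mb mb' e]; first by rewrite expn_gt0.
apply/mnmP; apply: (@digits_inj n b.+1) => // i; rewrite ltnS.
  by apply: leq_trans (ltnW mb); rewrite mdegE (bigD1 i) //= leq_addr.
by apply: leq_trans (ltnW mb'); rewrite mdegE (bigD1 i) //= leq_addr.
Qed.

Lemma exists_minimizer (T : Type) (S : T -> Prop) (f : T -> nat) x :
  S x -> exists2 y, S y & forall z, S z -> (f y <= f z)%N.
Proof.
move=> Sx; have ex : exists k, `[< exists2 y, S y & f y = k >].
  by exists (f x); apply/asboolP; exists x.
case: (ex_minnP ex) => k /asboolP [y Sy <-] min.
by exists y => // z Sz; apply: min; apply/asboolP; exists z.
Qed.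

Lemma wdeg1 n (m : 'X_{1..n}) : wdeg (fun=> 1%N) m = mdeg m.
Proof. by rewrite mdegE /wdeg; apply: eq_bigr => i _; rewrite mul1n. Qed.

Lemma wdeg_combine n p q (w w' : 'I_n -> nat) m :
  wdeg (fun i => p * w i + q * w' i)%N m = (p * wdeg w m + q * wdeg w' m)%N.
Proof.
rewrite /wdeg !big_distrr -big_split; apply: eq_bigr => i _ /=.
by rewrite mulnDl !mulnA.
Qed.

Lemma wdeg_axis n (j : 'I_n) m : wdeg (fun i => (i == j : nat)) m = m j.
Proof.
rewrite /wdeg (bigD1 j) //= eqxx mul1n big1 ?addn0 // => i /negbTE ->.
by rewrite mul0n.
Qed.

(** A weight concentrated on the j-th axis detects the smallest j-th
    coordinate; a small perturbation by a separating weight makes the minimizer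
    unique. *)
Lemma isolate_exponent n (S : 'X_{1..n} -> Prop) (e a : 'X_{1..n}) j :
  S e -> (e j < a j)%N ->
  exists w, exists m, [/\ forall i, (0 < w i)%N, S m,
    forall m', S m' -> wdeg w m' = wdeg w m -> m' = m
    & (wdeg w m < wdeg w a)%N].
Proof.
move=> Se eja.
pose N := (mdeg e).+1.
pose w0 (i : 'I_n) := (N * (i == j) + 1 * 1)%N.
have w0E m : wdeg w0 m = (N * m j + mdeg m)%N.
  by rewrite /w0 wdeg_combine wdeg_axis wdeg1 mul1n.
have [e0 Se0 min0] := exists_minimizer (wdeg w0) Se.
pose k0 := wdeg w0 e0.
have k0a : (k0 < wdeg w0 a)%N.
  apply: leq_ltn_trans (min0 _ Se) _; rewrite !w0E.
  apply: leq_trans (leq_addr _ _); apply: (@leq_trans (N * (e j).+1)%N).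
    by rewrite mulnS addnC ltn_add2r.
  by rewrite leq_mul2l eja orbT.
have mdeg_w0 m : (mdeg m <= wdeg w0 m)%N by rewrite w0E leq_addl.
have [kap kap0 kap_inj] := separating_weight n k0.+1.
have [m [Sm mk0] minm] := @exists_minimizer _ (fun m => S m /\ wdeg w0 m = k0)
  (wdeg kap) e0 (conj Se0 erefl).
pose L := (wdeg kap m).+1.
exists (fun i => L * w0 i + 1 * kap i)%N, m; split=> //.
- by move=> i; rewrite mul1n addn_gt0 kap0 orbT.
- move=> m' Sm'; rewrite !(wdeg_combine L 1 w0 kap) !mul1n mk0 => e'.
  have km' : (k0 <= wdeg w0 m')%N by apply: min0.
  have wm' : wdeg w0 m' = k0.
    apply/eqP; rewrite eqn_leq km' andbT leqNgt; apply/negP => lt.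
    have : (L * k0.+1 <= L * k0 + wdeg kap m)%N.
      by rewrite -e'; apply: leq_trans (leq_addr _ _); rewrite leq_mul2l lt orbT.
    by rewrite mulnS addnC leq_add2l ltnn.
  apply: kap_inj; [by rewrite ltnS -wm' | by rewrite ltnS -mk0 |].
  by move: e'; rewrite wm' => /addnI.
- rewrite !(wdeg_combine L 1 w0 kap) !mul1n mk0; apply: (@leq_trans (L * k0.+1)%N).
    by rewrite mulnS addnC ltn_add2r.
  by apply: leq_trans (leq_addr _ _); rewrite leq_mul2l k0a orbT.
Qed.

Section Vertex.
Variables (n d : nat) (S : nat -> 'X_{1..n} -> Prop).

(** [S i] is thought of as the support of the i-th coefficient; the points
    m / i for m in [S i] span the Newton polyhedron. *)
Definition face_point w i m := S i m /\
  forall i' m', S i' m' -> (wdeg w m * i' <= wdeg w m' * i)%N.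

Hypothesis S_range : forall i m, S i m -> (0 < i <= d)%N.
Hypothesis faces_are_points : forall w, (forall j, (0 < w j)%N) ->
  forall i m i' m', face_point w i m -> face_point w i' m' ->
  forall j, (i' * m j = i * m' j)%N.

(** The vertex m0 / i0 is the one selected by the weight (1, ..., 1). If a point
    lay below it along the j-th axis, tilting the weight towards that axis until
    the first such point reaches the face would produce a face with two
    points. *)
Lemma single_vertex i1 m1 : S i1 m1 ->
  exists i0 m0, S i0 m0 /\
    forall i m, S i m -> forall j, (i * m0 j <= i0 * m j)%N.
Proof.
move=> S1; pose deg (x : nat * 'X_{1..n}) := (mdeg x.2 * (d`! %/ x.1))%N.
have [[i0 m0] /= S0 min0] := @exists_minimizer _ (fun x => S x.1 x.2) deg (i1, m1) S1.
have fac i : (0 < i <= d)%N -> (d`! = i * (d`! %/ i))%N.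
  by move=> id; rewrite mulnC divnK // dvdn_fact.
have fac0 := fact_gt0 d.
have min0' i m : S i m -> (mdeg m0 * i <= mdeg m * i0)%N.
  move=> Sim; have := min0 (i, m) Sim; rewrite /deg /=.
  have fi := fac _ (S_range Sim); have fi0 := fac _ (S_range S0).
  move: (d`! %/ i0)%N (d`! %/ i)%N fi fi0 => q0 q fi fi0 le.
  rewrite -(leq_pmul2r fac0) {1}fi0 fi.
  have -> : (mdeg m0 * i * (i0 * q0) = (i * i0) * (mdeg m0 * q0))%N by ring.
  have -> : (mdeg m * i0 * (i * q) = (i * i0) * (mdeg m * q))%N by ring.
  by rewrite leq_mul2l le orbT.
exists i0, m0; split=> // i m Sim j; rewrite leqNgt; apply/negP => bad.
(* The tilt at which a point reaches the face is num / den; its denominator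
   divides D!, so that a smallest one exists. *)
pose bad_point (x : nat * 'X_{1..n}) := S x.1 x.2 /\ (i0 * x.2 j < x.1 * m0 j)%N.
pose num (x : nat * 'X_{1..n}) := (mdeg x.2 * i0 - mdeg m0 * x.1)%N.
pose den (x : nat * 'X_{1..n}) := (x.1 * m0 j - i0 * x.2 j)%N.
pose D := (d * m0 j)%N.
have [[i2 m2] /= [S2 bad2] min2] := @exists_minimizer _ bad_point
  (fun x => num x * (D`! %/ den x))%N (i, m) (conj Sim bad).
have den_range x : bad_point x -> (0 < den x <= D)%N.
  move=> [Sx bx]; rewrite /den subn_gt0 bx /= (leq_trans (leq_subr _ _)) //.
  by rewrite leq_mul2r; case/andP: (S_range Sx) => _ ->; rewrite orbT.
pose A2 := num (i2, m2); pose B2 := den (i2, m2).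
have B2r := den_range (i2, m2) (conj S2 bad2).
have tilt x : bad_point x -> (A2 * den x <= num x * B2)%N.
  move=> bx; have le := min2 _ bx; have dx := den_range _ bx.
  have D0 := fact_gt0 D.
  have f2 : (D`! = B2 * (D`! %/ B2))%N by rewrite mulnC divnK // dvdn_fact.
  have fx : (D`! = den x * (D`! %/ den x))%N by rewrite mulnC divnK // dvdn_fact.
  move: (D`! %/ B2)%N (D`! %/ den x)%N f2 fx le => q2 q f2 fx le.
  rewrite -(leq_pmul2r D0) {1}f2 fx.
  have -> : (A2 * den x * (B2 * q2) = (den x * B2) * (A2 * q2))%N by ring.
  have -> : (num x * B2 * (den x * q) = (den x * B2) * (num x * q))%N by ring.
  by rewrite leq_mul2l le orbT.
pose w (k : 'I_n) := (B2 * 1 + A2 * (k == j))%N.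
have wE m' : wdeg w m' = (B2 * mdeg m' + A2 * m' j)%N.
  by rewrite /w wdeg_combine wdeg1 wdeg_axis.
have w0 k : (0 < w k)%N by rewrite /w muln1 addn_gt0; case/andP: B2r => ->.
have low i' m' : S i' m' -> (wdeg w m0 * i' <= wdeg w m' * i0)%N.
  move=> S'; rewrite !wE; have := min0' _ _ S'.
  case: (ltnP (i0 * m' j) (i' * m0 j)) => [b'|g' le].
    have := tilt (i', m') (conj S' b'); rewrite /num /den /=.
    move: b'; clear; clearbody A2 B2.
    move: (mdeg m0) (mdeg m') (m' j) (m0 j) => x y z t.
    by move=> b' tl le; nia.
  clear -g' le; clearbody A2 B2; move: (mdeg m0) (mdeg m') (m' j) (m0 j) g' le.
  by move=> x y z t g' le; nia.
have eq2 : (wdeg w m0 * i2 = wdeg w m2 * i0)%N.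
  rewrite !wE; have := min0' _ _ S2; move: bad2; rewrite /A2 /B2 /num /den /=.
  clear; move: (mdeg m0) (mdeg m2) (m2 j) (m0 j) => x y z t.
  by move=> b le; nia.
have F0 : face_point w i0 m0 by [].
have i0_gt0 : (0 < i0)%N by case/andP: (S_range S0).
have F2 : face_point w i2 m2.
  split=> // i' m' S'; rewrite -(leq_pmul2r i0_gt0).
  have -> : (wdeg w m2 * i' * i0 = wdeg w m0 * i' * i2)%N.
    by rewrite mulnAC -eq2 mulnAC.
  by rewrite [X in (_ <= X)%N]mulnAC leq_mul2r low ?orbT.
have := faces_are_points w0 F0 F2 j.
by move=> e; move: bad2; rewrite e ltnn.
Qed.

End Vertex.

(** * Symmetric functions of the roots *)

Lemma eq_mmap (A B : comNzRingType) d (f : A -> B) (z z' : 'I_d -> B)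
    (t : {mpoly A[d]}) : z =1 z' -> mmap f z t = mmap f z' t.
Proof. by move=> zz'; apply: eq_bigr => m _; rewrite (mmap1_eq _ zz'). Qed.

Lemma mmap_comp_mpoly (A : comNzRingType) (B : comNzRingType) d k
    (f : {rmorphism A -> B}) (z : 'I_k -> B) (t : {mpoly A[d]})
    (lq : d.-tuple {mpoly A[k]}) :
  mmap f z (t \mPo lq) = mmap f (fun i => mmap f z (tnth lq i)) t.
Proof.
rewrite comp_mpolyEX rmorph_sum; apply: eq_bigr => m _ /=.
rewrite mmapZ comp_mpolyX rmorph_prod; congr (_ * _).
by apply: eq_bigr => i _; rewrite rmorphXn.
Qed.

Lemma mmap_mesym (A B : comNzRingType) d (f : {rmorphism A -> B})
    (z : 'I_d -> B) k :
  mmap f z (mesym d A k) = (mesym d B k).@[z].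
Proof.
rewrite /mesym !rmorph_sum; apply: eq_bigr => h _ /=.
rewrite !rmorph_prod; apply: eq_bigr => i _ /=.
by rewrite mmapX mmap1U mevalXU.
Qed.

Lemma rmorph_meval (A B : comNzRingType) d (f : {rmorphism A -> B})
    (v : 'I_d -> A) (t : {mpoly A[d]}) :
  f t.@[v] = mmap f (f \o v) t.
Proof.
rewrite [t.@[v]]/(mmap _ _ _) /mmap rmorph_sum; apply: eq_bigr => m _ /=.
rewrite rmorphM rmorph_prod; congr (_ * _); apply: eq_bigr => i _.
by rewrite rmorphXn.
Qed.

Lemma symmetric_in_coefficients (A : comNzRingType) d (p : {poly A})
    (Q : {mpoly A[d]}) : Q \is symmetric ->
  exists c : A, forall (B : idomainType) (f : {rmorphism A -> B}) (z : 'I_d -> B),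
    map_poly f p = \prod_i ('X - (z i)%:P) -> f c = mmap f z Q.
Proof.
move=> /sym_fundamental [t [<- _]].
exists t.@[fun i : 'I_d => (-1) ^+ i.+1 * p`_(d - i.+1)] => B f z pz.
rewrite rmorph_meval mmap_comp_mpoly; apply: eq_mmap => i /=.
rewrite tnth_mktuple mmap_mesym rmorphM rmorph_sign -coef_map pz.
pose zt := [tuple z i | i < d].
have := mroots_coeff zt (Ordinal (ltn_ord i : (i.+1 < d.+1)%N)).
rewrite big_map big_enum /= => ->; rewrite mulrA -expr2 sqrr_sign mul1r.
by apply: eq_mmap => j; rewrite tnth_mktuple.
Qed.

(** The h_ij = (G(z_i) - G(z_j)) / (Delta (z_i - z_j)) are permuted with the roots,
    so the product of the T - h_ij over ordered pairs is symmetric up to its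
    denominators. As V(z_i) P'(z_i) = Delta, multiplying it by the product of the
    V(z_i) leaves a power of Delta as only denominator. The polynomial F so
    obtained depends neither on the ring where P splits nor on the roots. *)
Lemma logarithmic_derivative_poly (A : comNzRingType) d (P V G : {poly A})
    (Delta : A) :
  exists F : {poly A}, forall (B : idomainType) (f : {rmorphism A -> B})
     (z : 'I_d -> B) (h : 'I_d -> 'I_d -> B),
    map_poly f P = \prod_i ('X - (z i)%:P) ->
    (forall i, f Delta = (map_poly f V).[z i] * \prod_(j | j != i) (z i - z j)) ->
    (forall i j, j != i -> f Delta * (h i j * (z i - z j))
                 = (map_poly f G).[z i] - (map_poly f G).[z j]) ->
    map_poly f F =
      (f Delta ^+ (d * d)%N)%:P * \prod_i \prod_(j | j != i) ('X - (h i j)%:P).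
Proof.
pose c : {rmorphism A -> {mpoly {poly A}[d]}} := (@mpolyC d _) \o polyC.
pose X i : {mpoly {poly A}[d]} := 'X_i.
pose Q : {mpoly {poly A}[d]} := \prod_(i < d) ((map_poly c V).[X i] *
  \prod_(j < d | j != i) (('X : {poly A})%:MP * c Delta * (X i - X j)
     - ((map_poly c G).[X i] - (map_poly c G).[X j]))).
pose ms (s : 'S_d) : {rmorphism {mpoly {poly A}[d]} -> {mpoly {poly A}[d]}} :=
  msym s.
have msX s i : ms s (X i) = X (s i) by rewrite /X /ms /= /msym mmapX mmap1U.
have msC s a : ms s a%:MP = a%:MP by rewrite /ms /= /msym mmapC.
have msV s (W : {poly A}) i : ms s (map_poly c W).[X i] = (map_poly c W).[X (s i)].
  rewrite -horner_map msX -map_poly_comp; congr (_.[_]).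
  by apply: eq_map_poly => a /=; rewrite msC.
have symQ : Q \is symmetric.
  apply/issymP => s; rewrite -[msym s Q]/(ms s Q) /Q rmorph_prod.
  rewrite [RHS](reindex_inj (@perm_inj _ s)).
  apply: eq_bigr => i _; rewrite rmorphM msV rmorph_prod; congr (_ * _).
  rewrite [RHS](reindex_inj (@perm_inj _ s)).
  apply: eq_big => [j|j _]; first by rewrite (inj_eq perm_inj).
  by rewrite !(rmorphB, rmorphM) !msV !msX !msC.
have [F FE] := symmetric_in_coefficients (map_poly polyC P) symQ.
exists F => B f z h Pz Dz hz.
have Pz' : map_poly (map_poly f) (map_poly polyC P) =
    \prod_i ('X - ((z i)%:P)%:P).
  have -> : map_poly (map_poly f) (map_poly polyC P) = map_poly polyC (map_poly f P).
    by apply/polyP=> i; rewrite !coef_map /= map_polyC.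
  rewrite Pz rmorph_prod; apply: eq_bigr => i _ /=.
  by rewrite rmorphB /= map_polyX map_polyC.
rewrite (FE _ (map_poly f) (fun i => (z i)%:P) Pz').
pose e : {rmorphism {mpoly {poly A}[d]} -> {poly B}} :=
  mmap (map_poly f) (fun i => (z i)%:P).
rewrite -[mmap _ _ Q]/(e Q).
have eX i : e (X i) = (z i)%:P by rewrite /e /X /= mmapX mmap1U.
have ec a : e (c a) = (f a)%:P by rewrite /e /c /= mmapC; exact: map_polyC.
have eh (W : {poly A}) i : e (map_poly c W).[X i] = ((map_poly f W).[z i])%:P.
  rewrite -(horner_map e) eX -horner_map -!map_poly_comp; congr (_.[_]).
  by apply: eq_map_poly => a /=; rewrite -ec.
have eT : e ('X : {poly A})%:MP = 'X by rewrite /e /= mmapC; exact: map_polyX.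
rewrite /Q rmorph_prod.
transitivity (\prod_(i < d) ((f Delta ^+ d)%:P *
   \prod_(j | j != i) ('X - (h i j)%:P))); last first.
  rewrite big_split /=; congr (_ * _).
  by rewrite prodr_const card_ord exprM [RHS]rmorphXn.
apply: eq_bigr => i _; rewrite rmorphM eh rmorph_prod.
transitivity (((map_poly f V).[z i])%:P * \prod_(j | j != i)
   ((f Delta * (z i - z j))%:P * ('X - (h i j)%:P))).
  congr (_ * _); apply: eq_bigr => j ji.
  rewrite !(rmorphB, rmorphM) /= eT ec !eX !eh -!rmorphB /= -(hz i j ji).
  rewrite !polyCM; ring.
rewrite big_split /= mulrA -rmorph_prod -rmorphM; congr (_%:P * _).
rewrite big_split /= mulrCA -Dz prodr_const -exprSr; congr (_ ^+ _).
rewrite -[RHS]card_ord [RHS](cardD1 i) inE add1n; congr _.+1.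
by apply: eq_card => j; rewrite !inE andbT.
Qed.

(** * Leading coefficients as eigenvectors *)

Lemma fcoefMn (A : comNzRingType) (f : fps A) m k :
  fcoef (f *+ m) k = fcoef f k *+ m.
Proof. by elim: m => [|m IH]; rewrite ?mulr0n ?fcoef0 // !mulrS fcoefD IH. Qed.

Section Eigen.
Variables (K E : fieldType) (iota : {rmorphism K -> E}) (D : E -> E).
Hypothesis derD : is_derivation D.
Hypothesis D_iota : forall c, D (iota c) = 0.

Definition eigen lambda x := D x = iota lambda * x.

Lemma der_iotaM c x : D (iota c * x) = iota c * D x.
Proof. by rewrite (derD_mul derD) D_iota mul0r add0r. Qed.

Lemma eigen0 l : eigen l 0.
Proof. by rewrite /eigen (derD0 derD) mulr0. Qed.

Lemma eigenB l x y : eigen l x -> eigen l y -> eigen l (x - y).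
Proof. by rewrite /eigen (derDB derD) mulrBr => -> ->. Qed.

Lemma eigen_sum l I (r : seq I) (Q : pred I) F :
  (forall i, Q i -> eigen l (F i)) -> eigen l (\sum_(i <- r | Q i) F i).
Proof.
move=> FE; rewrite /eigen (derD_sum derD) mulr_sumr.
by apply: eq_bigr => i /FE.
Qed.

Lemma eigenM l l' x y : eigen l x -> eigen l' y -> eigen (l + l') (x * y).
Proof.
rewrite /eigen (derD_mul derD) rmorphD mulrDl => -> ->.
by rewrite mulrA [x * (_ * _)]mulrCA.
Qed.

Lemma eigenZ l c x : eigen l x -> eigen l (iota c * x).
Proof. by rewrite /eigen der_iotaM => ->; rewrite mulrCA. Qed.

(** Eigenvectors for distinct eigenvalues are independent over K. *)
Lemma eigen_difference la lb l a b : a - b != 0 ->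
  eigen la a -> eigen lb b -> eigen l (a - b) -> eigen l a.
Proof.
move=> ab ea eb eab; have [<- //|lal] := eqVneq la l.
have rel : iota (la - l) * a = iota (lb - l) * b.
  move: eab; rewrite /eigen (derDB derD) ea eb !rmorphB !mulrBl mulrBr => e.
  apply/eqP; rewrite -subr_eq0; apply/eqP.
  transitivity ((iota la * a - iota lb * b) - (iota l * a - iota l * b)); first by ring.
  by rewrite e subrr.
have nz : iota (la - l) != 0 by rewrite fmorph_eq0 subr_eq0.
have aE : a = iota ((lb - l) / (la - l)) * b.
  by apply: (mulfI nz); rewrite rel mulrA -rmorphM [(la - l) * _]mulrC divfK // subr_eq0.
have ea' : eigen lb a by rewrite aE; apply: eigenZ.
have [a0|a0] := eqVneq a 0; first by rewrite a0; apply: eigen0.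
have lab : la = lb.
  by apply: (fmorph_inj iota); apply: (mulIf a0); rewrite -ea -ea'.
case/negP: lal; apply/eqP; apply: (fmorph_inj iota); apply: (mulIf ab).
by rewrite -eab -(eigenB (l := la)) // lab.
Qed.

Lemma eigen_coef_prod l (rs : seq E) k : (forall r, r \in rs -> eigen l r) ->
  eigen ((size rs - k)%N%:R * l) (\prod_(r <- rs) ('X - r%:P))`_k.
Proof.
elim: rs k => [|r rs IH] k rsE.
  rewrite big_nil coef1 mul0r /eigen rmorph0 mul0r.
  by case: eqP; rewrite ?(derD1 derD) ?(derD0 derD).
have {}IH j : eigen ((size rs - j)%N%:R * l) (\prod_(r <- rs) ('X - r%:P))`_j.
  by apply: IH => x xrs; apply: rsE; rewrite inE xrs orbT.
have er : eigen l r by apply: rsE; rewrite mem_head.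
rewrite big_cons mulrBl coefB coefXM coefCM; apply: eigenB.
  by case: k => [|k] /=; [apply: eigen0 | rewrite subSS; apply: IH].
have [krs|krs] := leqP k (size rs).
  rewrite /= subSn // -natr1 mulrDl mul1r addrC.
  exact: eigenM.
rewrite [X in r * X]nth_default ?mulr0; first exact: eigen0.
by rewrite size_prod_XsubC.
Qed.

(** The logarithmic derivative of a nonzero series is a series, because D kills
    the uniformizer t; its constant term is the eigenvalue. *)
Lemma fps_log_der (x : fps E) : x != 0 ->
  exists h e g, [/\ fps_der D x = h * x, x = tpow E e * g, residue g != 0
    & D (residue g) = residue h * residue g].
Proof.
move=> /fps_order [e [g [g0 xE]]].
have ug : g \is a GRing.unit by apply: (@fps_unitP _ g (residue g)^-1); rewrite mulVf.
have hg : fps_der D g / g * g = fps_der D g by rewrite divrK.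
exists (fps_der D g / g), e, g; split=> //; last first.
  by rewrite -[residue _ * _](rmorphM (@residue E)) hg.
rewrite xE mulrCA hg.
have Dt : fps_der D (tpow E e) = 0.
  apply/fpsP=> k; rewrite fcoef0 /=.
  by case: eqP; rewrite ?(derD1 derD) ?(derD0 derD).
by rewrite (derD_mul (fps_der_is_derivation derD)) Dt mul0r add0r.
Qed.

Hypothesis charE0 : [pchar E] =i pred0.

(** At the smallest order e of a difference of two series of the family, all
    nonzero leading differences are eigenvectors; the triangle relation
    (z_i - z_k) - (z_j - z_k) = z_i - z_j forces a common eigenvalue, and the
    vanishing of the sum passes from the differences to the z_i. *)
Lemma common_eigenvalue d (z : 'I_d -> fps E) : (1 < d)%N ->
  \sum_i z i = 0 ->
  (forall i j, j != i -> exists e g l,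
     [/\ z i - z j = tpow E e * g, residue g != 0 & eigen l (residue g)]) ->
  exists e l (y : 'I_d -> fps E), [/\ forall i, z i = tpow E e * y i,
    forall i, eigen l (residue (y i)) & exists i, residue (y i) != 0].
Proof.
move=> d1 sum0 zE; have d0 : d%:R != 0 :> E.
  by rewrite (pcharf0P _).1 // -lt0n ltnW.
have [ord ordP] : exists ord : 'I_d * 'I_d -> nat, forall p, p.2 != p.1 ->
    exists g l, [/\ z p.1 - z p.2 = tpow E (ord p) * g, residue g != 0
      & eigen l (residue g)].
  suff /choice [ord ordP] : forall p : 'I_d * 'I_d, exists e, p.2 != p.1 ->
    exists g l, [/\ z p.1 - z p.2 = tpow E e * g, residue g != 0
      & eigen l (residue g)] by exists ord.
  move=> [i j] /=; have [ij|ij] := eqVneq j i; first by exists 0%N.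
  by have [e [g [l H]]] := zE i j ij; exists e => _; exists g, l.
pose p0 : 'I_d * 'I_d := (Ordinal (ltnW d1), Ordinal d1).
have [[i0 j0] /= ij0 min0] := @exists_minimizer _ (fun p => p.2 != p.1) ord p0 isT.
pose e := ord (i0, j0).
have low i j k : (k < e)%N -> fcoef (z i - z j) k = 0.
  move=> ke; have [->|ij] := eqVneq j i; first by rewrite subrr fcoef0.
  have [g [l [-> _ _]]] := ordP (i, j) ij.
  by rewrite fcoef_tpowM (leq_trans ke) // min0.
have avg i k : fcoef (z i) k = d%:R^-1 * \sum_j fcoef (z i - z j) k.
  apply: (mulfI d0); rewrite mulVKf // -fcoef_sum sumrB sum0 subr0.
  by rewrite sumr_const card_ord mulr_natl fcoefMn.
have zlow i k : (k < e)%N -> fcoef (z i) k = 0.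
  by move=> ke; rewrite avg big1 ?mulr0 // => j _; apply: low.
pose y i := Fps (fun k => fcoef (z i) (k + e)%N).
have zy i : z i = tpow E e * y i by apply: tpow_divides => k; apply: zlow.
pose r i j := fcoef (z i - z j) e.
have rE i j : exists l, eigen l (r i j).
  have [->|ij] := eqVneq j i.
    by exists 0; rewrite /r subrr fcoef0; apply: eigen0.
  have [g [l [E1 g0 gE]]] := ordP (i, j) ij; exists l; rewrite /= in E1.
  rewrite /r E1 fcoef_tpowM; have := min0 (i, j) ij.
  rewrite leq_eqVlt => /predU1P[eE|->]; last exact: eigen0.
  by rewrite /e eE ltnn subnn.
have [r0 [l r0E]] : r i0 j0 != 0 /\ exists l, eigen l (r i0 j0).
  split=> //; have [g [l [E1 g0 _]]] := ordP (i0, j0) ij0.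
  by rewrite /= in E1; rewrite /r E1 fcoef_tpowM ltnn subnn.
have r0iE i : eigen l (r i0 i).
  have rdiff : r i0 i - r j0 i = r i0 j0 by rewrite /r !fcoefB; ring.
  have [la ea] := rE i0 i; have [lb eb] := rE j0 i.
  by apply: (@eigen_difference la lb l _ (r j0 i)); rewrite // rdiff.
have y0 i : residue (y i) = fcoef (z i) e by [].
have yi0 : eigen l (residue (y i0)).
  rewrite y0 avg -(rmorph_nat iota) -fmorphV; apply: eigenZ.
  by apply: eigen_sum => j _; apply: r0iE.
have yE i : eigen l (residue (y i)).
  have -> : residue (y i) = residue (y i0) - r i0 i.
    by rewrite !y0 /r fcoefB opprB addrC subrK.
  exact: eigenB.
exists e, l, y; split=> //.
have [yi|yi] := eqVneq (residue (y i0)) 0; last by exists i0.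
exists j0; apply: contra r0 => /eqP yj.
by rewrite /r fcoefB -!y0 yi yj subrr.
Qed.

End Eigen.

(** * Monomials and units among power series in several variables *)

Section Monomials.
Variables (n : nat) (K : comNzRingType).
Implicit Types (f g : mseries n K) (a b m : 'X_{1..n}).

Lemma scoefM_sum f g m : scoef (f * g) m =
  \sum_(k : 'X_{1..n < (mdeg m).+1, (mdeg m).+1} | m == (k.1 + k.2)%MM)
    scoef f k.1 * scoef g k.2.
Proof. by []. Qed.

Lemma scoefMn_eq0 f g m :
  (forall a b, m = (a + b)%MM -> scoef f a * scoef g b = 0) ->
  scoef (f * g) m = 0.
Proof. by move=> fg; rewrite scoefM_sum big1 // => k /eqP /fg. Qed.

Lemma scoef_monomM a f m : scoef (mseries_monom K a * f) m =
  if (a <= m)%MM then scoef f (m - a)%MM else 0.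
Proof.
case: ifP => am; last first.
  apply: scoefMn_eq0 => b c mE /=; case: eqP => [ba|_]; last by rewrite mul0r.
  by move: am; rewrite mE ba lem_addr.
have da : (mdeg a < (mdeg m).+1)%N.
  by rewrite ltnS -(submK am) mdegD leq_addl.
have dma : (mdeg (m - a)%MM < (mdeg m).+1)%N.
  by rewrite ltnS -[X in (_ <= mdeg X)%N](submK am) mdegD leq_addr.
rewrite scoefM_sum (bigD1 (BMultinom da, BMultinom dma)) /=; last first.
  by rewrite addmC submK.
rewrite eqxx mul1r big1 ?addr0 // => -[k1 k2] /= /andP[/eqP mE ne].
case: eqP => [k1a|_]; last by rewrite mul0r.
have k2E : (m - a)%MM = k2.
  by transitivity (k1 + k2 - a)%MM; [rewrite -mE | rewrite k1a addmC addmK].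
by case/negP: ne; apply/eqP; congr (_, _); apply: val_inj.
Qed.

Lemma monomD a b :
  mseries_monom K (a + b)%MM = mseries_monom K a * mseries_monom K b.
Proof.
apply/mseriesP=> m; rewrite scoef_monomM /=; case: ifP => am.
  by rewrite -[in LHS](submK am) [(_ + a)%MM]addmC eqm_add2l.
by case: eqP => // mE; move: am; rewrite mE lem_addr.
Qed.

Lemma monom0 : mseries_monom K (0%MM : 'X_{1..n}) = 1.
Proof. by []. Qed.

Lemma monomX a k : mseries_monom K a ^+ k = mseries_monom K (a *+ k)%MM.
Proof.
elim: k => [|k IH]; first by rewrite mulm0n monom0.
by rewrite exprS IH -monomD mulmS.
Qed.

Lemma monom_divides a f : (forall m, scoef f m != 0 -> (a <= m)%MM) ->
  f = mseries_monom K a * MSeries (fun m => scoef f (m + a)%MM).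
Proof.
move=> fa; apply/mseriesP=> m; rewrite scoef_monomM /=.
case: ifP => am; first by rewrite submK.
by apply: contraFeq am; apply: fa.
Qed.

(** The constant term of a series with invertible constant term makes the
    equations for the coefficients of an inverse triangular. *)
Lemma mseries_unitP f c : c * scoef f 0%MM = 1 -> f \is a GRing.unit.
Proof.
move=> cf; pose F (g : 'X_{1..n} -> K) m := c * ((m == 0%MM)%:R -
  \sum_(k : 'X_{1..n < (mdeg m).+1, (mdeg m).+1}
     | (m == (k.1 + k.2)%MM) && (k.2 != 0%MM :> 'X_{1..n})) g k.1 * scoef f k.2).
have [|g gE] := @recursion_on_measure _ K (@mdeg n) F 0.
  move=> g g' m gg'; rewrite /F; congr (_ * (_ - _)).
  apply: eq_bigr => k /andP[/eqP mE k20]; rewrite gg' //.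
  apply: (@leq_trans (mdeg k.1 + mdeg k.2)%N); last by rewrite -mdegD -mE.
  by rewrite -[X in (X < _)%N]addn0 ltn_add2l lt0n mdeg_eq0.
have gf : MSeries g * f = 1.
  apply/mseriesP=> m; rewrite scoefM_sum.
  have dm : (mdeg m < (mdeg m).+1)%N by [].
  have d0 : (mdeg (0%MM : 'X_{1..n}) < (mdeg m).+1)%N by rewrite mdeg0.
  rewrite (bigD1 (BMultinom dm, BMultinom d0)) /= ?addm0 //.
  rewrite gE /F mulrC mulrA [_ * c]mulrC cf mul1r -addrA.
  rewrite [X in _ + (_ + X)](eq_bigl (fun k : 'X_{1..n < _, _} =>
    (m == (k.1 + k.2)%MM) && (k.2 != 0%MM :> 'X_{1..n}))); first by rewrite addNr addr0.
  move=> [k1 k2]; apply: andb_id2l => /eqP mE; congr (~~ _).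
  apply/eqP/eqP => [/(congr1 (fun p => val p.2)) // | k20].
  have k1E : val k1 = m by rewrite -[LHS]addm0 -[X in (_ + X)%MM]k20; exact: esym mE.
  by congr (_, _); apply: val_inj.
by apply/unitrP; exists (MSeries g); split=> //; rewrite mulrC.
Qed.

End Monomials.

(** * Quasi-ordinary polynomials along test curves *)

Lemma deriv_prod_XsubC_root (A : comNzRingType) d (z : 'I_d -> A) i :
  (\prod_j ('X - (z j)%:P))^`().[z i] = \prod_(j | j != i) (z i - z j).
Proof.
rewrite (bigD1 i) //= derivM derivXsubC mul1r hornerD hornerM.
rewrite hornerXsubC subrr mul0r addr0 horner_prod.
by apply: eq_bigr => j _; rewrite hornerXsubC.
Qed.

Lemma natr_inj (K : fieldType) : [pchar K] =i pred0 ->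
  injective (fun k => k%:R : K).
Proof.
move=> charK0 x y; wlog xy : x y / (x <= y)%N => [W|e].
  by case/orP: (leq_total x y) => [/W //|/W yx /esym /yx].
apply/eqP; rewrite eqn_leq xy -subn_eq0 -((pcharf0P K).1 charK0) // natrB //.
by move: e => /= <-; rewrite subrr.
Qed.

Section QuasiOrdinary.
Variables (K : closedFieldType) (charK0 : [pchar K] =i pred0).
Variables (n d : nat) (P V W : {poly mseries n K}).
Variables (alpha : 'X_{1..n}) (U : mseries n K).
Hypotheses (mP : P \is monic) (sP : size P = d.+1) (d_gt1 : (1 < d)%N).
Hypothesis P_sub : P`_d.-1 = 0.
Hypothesis U0 : scoef U 0%MM != 0.
Let Delta := mseries_monom K alpha * U.
Hypothesis bezout : Delta%:P = W * P + V * P^`().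

Local Notation L := (laurent K).

Lemma test_curve_roots (mu w : 'I_n -> nat) (w0 : forall i, (0 < w i)%N) :
  exists N (N0 : (0 < N)%N) (z : 'I_d -> fps L),
    map_poly (test_curve K mu w0 N0) P = \prod_i ('X - (z i)%:P).
Proof.
have [N [N0 [rs rsE]]] := test_curve_splits charK0 mu w0 mP.
have srs : size rs = d.
  have := congr1 (size \o @polyseq _) rsE; rewrite /= size_prod_XsubC.
  rewrite size_map_poly_id0 ?sP => [[]//|].
  by rewrite (monicP mP) rmorph1 oner_neq0.
exists N, N0, (fun i => rs`_i); rewrite rsE (big_nth 0) big_mkord srs.
by [].
Qed.

Section AlongCurve.
Variables (mu w : 'I_n -> nat) (w_gt0 : forall i, (0 < w i)%N).
Variables (N : nat) (N_gt0 : (0 < N)%N) (z : 'I_d -> fps L).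
Local Notation phi := (test_curve K mu w_gt0 N_gt0).
Hypothesis Pz : map_poly phi P = \prod_i ('X - (z i)%:P).

Local Notation dN := (@ram_theta K N).
Local Notation D := (fps_der dN).

Let D_is_derivation : is_derivation D.
Proof. exact: fps_der_is_derivation (@ram_theta_is_derivation K N). Qed.

Lemma D_phi f : D (phi f) = phi (mseries_der mu f).
Proof. exact: ram_theta_test_curve. Qed.

Lemma phi_monom a :
  phi (mseries_monom K a) = fps_const (spow K (N * wdeg mu a)%N) * tpow L (N * wdeg w a).
Proof.
apply: etrans (curve_monom _ _ (scale_gt0 N_gt0 w_gt0) a) _.
by rewrite wdegZ mmap1_spow.
Qed.

Lemma residue_phi f : residue (phi f) = cst K (scoef f 0%MM).
Proof. exact: residue_curve. Qed.

Lemma phi_monom_neq0 a : phi (mseries_monom K a) != 0.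
Proof.
rewrite phi_monom mulf_neq0 ?tpow_neq0 //; apply/eqP=> /fpsP /(_ 0%N) /= /eqP.
by rewrite /spow tofrac_eq0; apply/negP; apply: tpow_neq0.
Qed.

Lemma phi_Delta_neq0 : phi Delta != 0.
Proof.
rewrite /Delta rmorphM mulf_neq0 ?phi_monom_neq0 //; apply/eqP=> U0'.
by move: U0; rewrite -(fmorph_eq0 (cst K)) -residue_phi U0' rmorph0 eqxx.
Qed.

Lemma discriminant_at_root i :
  phi Delta = (map_poly phi V).[z i] * \prod_(j | j != i) (z i - z j).
Proof.
have := congr1 (fun p => (map_poly phi p).[z i]) bezout.
rewrite /= map_polyC /= hornerC => ->.
rewrite rmorphD !rmorphM /= hornerD !hornerM -deriv_map Pz deriv_prod_XsubC_root.
by rewrite horner_prod (bigD1 i) //= hornerXsubC subrr mul0r mulr0 add0r.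
Qed.

Lemma roots_distinct i j : j != i -> z i - z j != 0.
Proof.
move=> ji; apply: contra phi_Delta_neq0 => /eqP zij.
by rewrite (discriminant_at_root i) (bigD1 j) //= zij mul0r mulr0.
Qed.

(** Differentiating P(z) = 0 gives P'(z) Dz = - P^D(z), where P^D has the
    derivatives of the coefficients of P as coefficients; multiplication by V(z)
    turns P'(z) into the discriminant. *)
Definition der_numerator := - (V * map_poly (mseries_der (K := K) mu) P).

Lemma der_root i : phi Delta * D (z i) = (map_poly phi der_numerator).[z i].
Proof.
have root_i : (map_poly phi P).[z i] = 0.
  by rewrite Pz horner_prod (bigD1 i) //= hornerXsubC subrr mul0r.
have := derD_horner D_is_derivation (map_poly phi P) (z i).
rewrite root_i (derD0 D_is_derivation).
have der0 : mseries_der mu (0 : mseries n K) = 0.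
  by apply/mseriesP=> m; rewrite /= mulr0.
have -> : map_poly D (map_poly phi P) = map_poly phi (map_poly (mseries_der mu) P).
  apply/polyP=> k; rewrite coef_map_id0 ?(derD0 D_is_derivation) //.
  by rewrite !coef_map D_phi coef_map_id0.
rewrite Pz deriv_prod_XsubC_root => /esym/eqP; rewrite addr_eq0 => /eqP e.
rewrite (discriminant_at_root i) -mulrA.
rewrite /der_numerator rmorphN rmorphM /= hornerN hornerM e.
by rewrite mulrN opprK.
Qed.

Lemma log_derivatives :
  exists h : 'I_d -> 'I_d -> fps L,
    (forall i j, j != i -> phi Delta * (h i j * (z i - z j))
        = (map_poly phi der_numerator).[z i] - (map_poly phi der_numerator).[z j])
    /\ forall i j, j != i -> exists e g, [/\ z i - z j = tpow L e * g,
        residue g != 0 & dN (residue g) = residue (h i j) * residue g].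
Proof.
have [h hP] : exists h : 'I_d * 'I_d -> fps L, forall p, p.2 != p.1 ->
    exists e g, [/\ D (z p.1 - z p.2) = h p * (z p.1 - z p.2),
      z p.1 - z p.2 = tpow L e * g, residue g != 0
      & dN (residue g) = residue (h p) * residue g].
  suff /choice [h hP] : forall p : 'I_d * 'I_d, exists h, p.2 != p.1 ->
    exists e g, [/\ D (z p.1 - z p.2) = h * (z p.1 - z p.2),
      z p.1 - z p.2 = tpow L e * g, residue g != 0
      & dN (residue g) = residue h * residue g] by exists h.
  move=> p; have [ij|ij] := eqVneq p.2 p.1; first by exists 0.
  have [h [e [g H]]] := fps_log_der (@ram_theta_is_derivation K N) (roots_distinct ij).
  by exists h => _; exists e, g.
exists (fun i j => h (i, j)); split=> i j ji.
  have [e [g [/= <- _ _ _]]] := hP (i, j) ji.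
  by rewrite (derDB D_is_derivation) mulrBr !der_root.
by have [e [g [_ E1 g0 gE]]] := hP (i, j) ji; exists e, g.
Qed.

End AlongCurve.

Section Integrality.
Variables (mu : 'I_n -> nat) (F : {poly mseries n K}).
Hypothesis FP : forall (B : idomainType) (f : {rmorphism mseries n K -> B})
     (z : 'I_d -> B) (h : 'I_d -> 'I_d -> B),
    map_poly f P = \prod_i ('X - (z i)%:P) ->
    (forall i, f Delta = (map_poly f V).[z i] * \prod_(j | j != i) (z i - z j)) ->
    (forall i j, j != i -> f Delta * (h i j * (z i - z j))
       = (map_poly f (der_numerator mu)).[z i] - (map_poly f (der_numerator mu)).[z j]) ->
    map_poly f F =
      (f Delta ^+ (d * d)%N)%:P * \prod_i \prod_(j | j != i) ('X - (h i j)%:P).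

Let a := (alpha *+ (d * d)%N)%MM.

(** Along every curve the coefficients of F are divisible by the image of the
    monomial X^a; a curve whose weight isolates an offending exponent shows
    that they are divisible by X^a themselves. *)
Lemma F_divisible k m : scoef F`_k m != 0 -> (a <= m)%MM.
Proof.
move=> Fm; apply/mnm_lepP => j; rewrite leqNgt; apply/negP => mj.
have [w [m0 [w0 Fm0 uniq lt]]] :=
  @isolate_exponent n (fun m => scoef F`_k m != 0) m a j Fm mj.
have [N [N0 [z Pz]]] := test_curve_roots mu w0.
have [h [hz _]] := log_derivatives Pz.
have := congr1 (fun p : {poly fps L} => fcoef p`_k (N * wdeg w m0)%N)
  (FP Pz (discriminant_at_root Pz) hz).
rewrite /= coefCM coef_map /Delta rmorphM exprMn -rmorphXn monomX -/a phi_monom.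
rewrite -!mulrA fcoef_constM fcoef_tpowM ltn_mul2l N0 lt mulr0.
rewrite (fcoef_test_curve _ _ _ _ (ltnSn _)).
have b0 : (mdeg m0 < (N * wdeg w m0).+1)%N.
  by rewrite ltnS (leq_trans (mdeg_le_wdeg m0 w0)) // leq_pmull.
rewrite (bigD1 (BMultinom b0)) //= big1 ?addr0 => [/eqP|m1 /andP[/eqP e1]].
  rewrite mulf_eq0 (fmorph_eq0 (cst K)) (negbTE Fm0) /spow tofrac_eq0.
  by rewrite (negbTE (tpow_neq0 _ _)).
rewrite -val_eqE /= => ne; have [->|Fm1] := eqVneq (scoef F`_k m1) 0.
  by rewrite rmorph0 mul0r.
case/eqP: ne; apply: uniq => //; apply/eqP.
by rewrite -(eqn_pmul2l N0) e1.
Qed.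

Let Fquo k : mseries n K := MSeries (fun m => scoef F`_k (m + a)%MM).

(** Once X^a is divided out, the product of the T - h_ij is, up to a unit, the image
    of a polynomial over K[[X]]; at t = 0 only the constant terms of its coefficients
    remain, so the h_ij(0) are roots of a polynomial over the algebraically closed
    field K. *)
Lemma log_derivative_constant w (w0 : forall i, (0 < w i)%N) N (N0 : (0 < N)%N)
    (z : 'I_d -> fps L) (h : 'I_d -> 'I_d -> fps L) :
  map_poly (test_curve K mu w0 N0) P = \prod_i ('X - (z i)%:P) ->
  (forall i j, j != i -> test_curve K mu w0 N0 Delta * (h i j * (z i - z j))
       = (map_poly (test_curve K mu w0 N0) (der_numerator mu)).[z i]
         - (map_poly (test_curve K mu w0 N0) (der_numerator mu)).[z j]) ->
  forall i j, j != i -> exists c, residue (h i j) = cst K c.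
Proof.
set phi := test_curve K mu w0 N0 => Pz hz i j ji.
pose H := \prod_i \prod_(j | j != i) ('X - (h i j)%:P).
have FH : map_poly phi F = (phi Delta ^+ (d * d)%N)%:P * H.
  exact: FP Pz (discriminant_at_root Pz) hz.
have quo k : phi (Fquo k) = phi U ^+ (d * d)%N * H`_k.
  apply: (mulfI (phi_monom_neq0 mu w0 N0 a)); rewrite -/phi -rmorphM.
  rewrite -[mseries_monom K a * Fquo k](monom_divides (f := F`_k)); last first.
    by move=> m; apply: F_divisible.
  rewrite -coef_map FH coefCM /Delta rmorphM exprMn -(rmorphXn phi (d * d)%N (mseries_monom K alpha)) monomX -/a.
  by rewrite mulrA.
pose u := scoef U 0%MM ^+ (d * d)%N.
have u0 : u != 0 by rewrite expf_neq0.
pose q : {poly K} := \poly_(k < size H) (scoef (Fquo k) 0%MM / u).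
have resH : map_poly (@residue L) H = map_poly (cst K) q.
  apply/polyP=> k; rewrite !coef_map coef_poly.
  case: ltnP => [kH|Hk]; last by rewrite nth_default // !rmorph0.
  apply: (mulfI (x := cst K u)); first by rewrite fmorph_eq0.
  rewrite -[RHS]rmorphM [u * _]mulrC divfK // -(residue_phi mu w0 N0) -/phi quo.
  rewrite [RHS]rmorphM; congr (_ * _); rewrite rmorphXn -(residue_phi mu w0 N0 U).
  exact: esym (rmorphXn (@residue L) _ _).
have mH : map_poly (@residue L) H \is monic.
  by apply: monic_map; apply: monic_prod => i' _; apply: monic_prod_XsubC.
have mq : q \is monic by rewrite -(map_monic (cst K)) -resH.
have [rs rsE] := closed_field_poly_normal q.
have root0 : H.[h i j] = 0.
  rewrite /H horner_prod (bigD1 i) //= horner_prod (bigD1 j) //=.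
  by rewrite hornerXsubC subrr !mul0r.
have rootH : (map_poly (@residue L) H).[residue (h i j)] = 0.
  by rewrite horner_map root0 rmorph0.
move: rootH; rewrite resH rsE (monicP mq) scale1r map_prod_XsubC => /eqP.
rewrite -[_ == 0]/(root _ _) -(big_map (cst K) xpredT (fun r => 'X - r%:P)).
by rewrite root_prod_XsubC => /mapP [c _ ->]; exists c.
Qed.

End Integrality.

(** Write z_i = t^e y_i. The coefficient of t^(e m) in a_m is, up to sign, the m-th
    elementary symmetric function of the y_i(0), which all are eigenvectors with
    eigenvalue l; since these are not all zero, some of these functions with m > 0
    is nonzero. *)
Lemma initial_forms_eigen (mu w : 'I_n -> nat) (w0 : forall i, (0 < w i)%N) :
  exists N (N0 : (0 < N)%N) e l,
    [/\ forall m k, (m <= d)%N -> (k < e * m)%N ->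
          fcoef (test_curve K mu w0 N0 P`_(d - m)) k = 0,
        forall m, (m <= d)%N -> eigen (cst K) (@ram_theta K N) (m%:R * l)
          (fcoef (test_curve K mu w0 N0 P`_(d - m)) (e * m)%N)
      & exists2 m, (0 < m <= d)%N &
          fcoef (test_curve K mu w0 N0 P`_(d - m)) (e * m)%N != 0].
Proof.
have [F FP] := logarithmic_derivative_poly d P V (der_numerator mu) Delta.
have [N [N0 [z Pz]]] := test_curve_roots mu w0.
have [h [hz hd]] := log_derivatives Pz.
have hc := log_derivative_constant FP Pz hz.
have derN := @ram_theta_is_derivation K N.
have dN_cst c : ram_theta N (cst K c) = 0 by rewrite /ram_theta ltheta_cst mulr0.
have seqE (x : 'I_d -> fps L) (f : fps L -> fps L) :
    \prod_i ('X - (f (x i))%:P) = \prod_(r <- [seq x i | i : 'I_d]) ('X - (f r)%:P).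
  by rewrite big_map big_enum.
have sub0 : (map_poly (test_curve K mu w0 N0) P)`_d.-1 = 0.
  by apply: etrans (coef_map _ _ _) _; rewrite P_sub; apply: rmorph0.
have sum0 : \sum_i z i = 0.
  have := @coefPn_prod_XsubC _ [seq z i | i : 'I_d].
  rewrite -(seqE z id) -Pz size_map size_enum_ord sub0.
  rewrite big_map big_enum /= => H; apply/eqP; rewrite -oppr_eq0 -H //.
  by rewrite -lt0n ltnW.
have [|e [l [y [zy ey [i1 yi1]]]]] := common_eigenvalue derN dN_cst
    (laurent_char0 charK0) d_gt1 sum0.
  move=> i j ji; have [e [g [E1 g0 gE]]] := hd i j ji.
  have [c cE] := hc i j ji; exists e, g, c; split=> //.
  by rewrite /eigen gE cE.
pose ys := [seq y i | i : 'I_d].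
have sys : size ys = d by rewrite size_map size_enum_ord.
pose Q := \prod_(r <- ys) ('X - r%:P).
have PQ m : (m <= d)%N ->
    test_curve K mu w0 N0 P`_(d - m) = tpow L (e * m) * Q`_(d - m).
  move=> md; rewrite -coef_map Pz.
  under eq_bigr => i _ do rewrite zy.
  rewrite (seqE y ( *%R (tpow L e))) coef_prod_scale ?sys ?leq_subr //.
  by rewrite subKn // tpowM.
have resQ k : residue Q`_k = (\prod_(r <- map (@residue L) ys) ('X - r%:P))`_k.
  by rewrite -coef_map map_prod_XsubC big_map.
exists N, N0, e, l; split=> [m k md km|m md|].
- by rewrite PQ // fcoef_tpowM km.
- rewrite PQ // fcoef_tpowM ltnn subnn -/(residue _) resQ.
  have := @eigen_coef_prod _ _ (cst K) (@ram_theta K N) derN l (map (@residue L) ys) (d - m).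
  rewrite size_map sys subKn //; apply => r /mapP [x /mapP [i _ ->] ->].
  exact: ey.
apply: contrapT => none.
have QX : \prod_(r <- map (@residue L) ys) ('X - r%:P) = 'X^d.
  apply/polyP=> k; rewrite coefXn -resQ; case: (ltngtP k d) => [kd|dk|->].
  - apply: contrapT => /eqP Qk; apply: none; exists (d - k)%N.
      by rewrite subn_gt0 kd leq_subr.
    rewrite PQ ?leq_subr // fcoef_tpowM ltnn subnn subKn //; exact: ltnW.
  - by rewrite nth_default ?rmorph0 // /Q size_prod_XsubC sys.
  - have := lead_coef_prod_XsubC ys xpredT id.
    by rewrite lead_coefE size_prod_XsubC sys /Q => ->; rewrite rmorph1.
have := congr1 (fun p => p.[residue (y i1)]) QX.
rewrite /= hornerXn => /esym/eqP; apply/negP.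
rewrite -[X in X == _]/(_ ^+ _) (_ : (\prod_(r <- _) _).[_] = 0); last first.
  apply/eqP; rewrite -[_ == 0]/(root _ _) root_prod_XsubC; apply: map_f.
  by apply: map_f; rewrite mem_enum.
by rewrite expf_eq0 (negbTE yi1) andbF.
Qed.

(** The monomials s^k are eigenvectors of s d/ds for distinct eigenvalues. *)
Lemma eigen_exponents N (b : nat) (mu : 'I_n -> nat) (Q : pred 'X_{1..n < b})
    (f : 'X_{1..n} -> K) c : (0 < N)%N ->
  (forall m m' : 'X_{1..n < b}, Q m -> Q m' -> wdeg mu m = wdeg mu m' -> m = m') ->
  let x := \sum_(m : 'X_{1..n < b} | Q m) cst K (f m) * spow K (N * wdeg mu m)%N in
  forall m : 'X_{1..n < b}, Q m -> f m != 0 ->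
    x != 0 /\ (eigen (cst K) (@ram_theta K N) c x -> (wdeg mu m)%:R = c).
Proof.
move=> N0 mu_inj x m Qm fm; have NK : N%:R != 0 :> K.
  by rewrite (pcharf0P _).1 // -lt0n.
pose X : fps K := \sum_(m : 'X_{1..n < b} | Q m)
  fps_const (f m) * tpow K (N * wdeg mu m).
have xX : x = X%:F.
  rewrite /X /x (rmorph_sum (@FracField.tofrac (fps K))).
  by apply: eq_bigr => m' _; exact: esym (tofracM _ _).
have Xm : fcoef X (N * wdeg mu m) = f m.
  rewrite fcoef_sum (bigD1 m) // fcoef_constM fcoef_tpow eqxx mulr1.
  rewrite big1 => [|m' /andP[Qm' mm']]; first exact: addr0.
  rewrite fcoef_constM fcoef_tpow eqn_pmul2l //.
  by case: eqP => [/(mu_inj _ _ Qm Qm') e|]; rewrite ?mulr0 // e eqxx in mm' *.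
split.
  rewrite xX tofrac_eq0; apply/eqP => X0; move: fm.
  by rewrite -Xm X0 fcoef0 eqxx.
rewrite /eigen /ram_theta xX /ltheta (frac_derF (@theta_is_derivation K)) /cst /=.
rewrite -!tofracM => /eqP; rewrite tofrac_eq => /eqP /fpsP /(_ (N * wdeg mu m)%N).
rewrite !fcoef_constM fcoef_theta Xm mulrA => /(mulIf fm) <-.
by rewrite natrM mulKf.
Qed.

(** P_(d - m) is the coefficient a_m. *)
Definition support m (g : 'X_{1..n}) := (0 < m <= d)%N /\ scoef P`_(d - m) g != 0.

Lemma test_curve_coef_neq0 (mu w : 'I_n -> nat) (w0 : forall i, (0 < w i)%N) N (N0 : (0 < N)%N) f k :
  fcoef (test_curve K mu w0 N0 f) k != 0 ->
  exists2 g, scoef f g != 0 & (N * wdeg w g = k)%N.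
Proof.
rewrite (fcoef_test_curve _ _ _ _ (ltnSn k)) => nz; apply: contrapT => nex.
case/eqP: nz; apply: big1 => g /eqP gk.
have [->|fg] := eqVneq (scoef f g) 0; first by rewrite rmorph0 mul0r.
by case: nex; exists g.
Qed.

Lemma support_nonempty : exists m g, support m g.
Proof.
have w0 (i : 'I_n) : (0 < 1)%N by [].
have [N [N0 [e [l [_ _ [m md nz]]]]]] := initial_forms_eigen (fun=> 0%N) w0.
by have [g fg _] := test_curve_coef_neq0 nz; exists m, g.
Qed.

(** On the face of a weight the a_m have initial forms which are eigenvectors
    for m * l, so their exponents g satisfy mu.g = m * l for the separating
    weight mu. *)
Lemma faces_are_points w : (forall j, (0 < w j)%N) ->
  forall m g m' g', face_point support w m g -> face_point support w m' g' ->
  forall j, (m' * g j = m * g' j)%N.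
Proof.
move=> w0 m g m' g' [[md fg] ming] [[md' fg'] ming'].
(* The degrees of m' g and m g' are below b, as well as those of all exponents
   of the same weighted degree as g or g'. *)
pose b := (d * (wdeg w g + wdeg w g')).+1.
have [mu mu0 mu_inj] := separating_weight n b.
have [N [N0 [e [l [low eig [m1 md1 nz1]]]]]] := initial_forms_eigen mu w0.
have [g1 fg1 g1E] := test_curve_coef_neq0 nz1.
have key k h : (0 < k <= d)%N -> scoef P`_(d - k) h != 0 ->
    (wdeg w h <= wdeg w g + wdeg w g')%N ->
    (forall i' m', support i' m' -> (wdeg w h * i' <= wdeg w m' * k)%N) ->
    (wdeg mu h)%:R = k%:R * l.
  move=> kd fh hb minh; case/andP: (kd) => k0 kd'.
  pose B := (N * wdeg w h).+1.
  have dh : (mdeg h < B)%N.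
    by rewrite ltnS (leq_trans (mdeg_le_wdeg h w0)) // leq_pmull.
  have coefE := fcoef_test_curve mu w0 N0 P`_(d - k) (ltnSn (N * wdeg w h)%N).
  have inj (x x' : 'X_{1..n < B}) : (N * wdeg w x == N * wdeg w h)%N ->
      (N * wdeg w x' == N * wdeg w h)%N -> wdeg mu x = wdeg mu x' -> x = x'.
    rewrite !eqn_pmul2l // => /eqP xh /eqP xh' /mu_inj e'; apply: val_inj.
    have small y : wdeg w y = wdeg w h -> (mdeg y < b)%N.
      move=> yh; rewrite ltnS; apply: leq_trans (mdeg_le_wdeg y w0) _.
      by rewrite yh (leq_trans hb) // leq_pmull // ltnW.
    by apply: e'; apply: small.
  have [nz eqn] := eigen_exponents (k%:R * l) N0 inj
    (m := BMultinom dh) (eqxx _) fh.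
  rewrite -coefE in nz eqn.
  suff eE : (N * wdeg w h = e * k)%N by apply: eqn; rewrite eE; apply: eig.
  apply/eqP; rewrite eqn_leq; apply/andP; split; last first.
    by rewrite leqNgt; apply: contra nz => lt; rewrite low.
  have m1_gt0 : (0 < m1)%N by case/andP: md1.
  rewrite -(leq_pmul2r m1_gt0) -!mulnA [(k * m1)%N]mulnC !mulnA -g1E -!mulnA.
  by rewrite leq_mul2l minh ?orbT.
have km := key m g md fg (leq_addr _ _) ming.
have km' := key m' g' md' fg' (leq_addl _ _) ming'.
have eK : (m' * wdeg mu g)%N%:R = (m * wdeg mu g')%N%:R :> K.
  by rewrite !natrM km km' mulrCA.
have wM k h : wdeg mu (h *+ k)%MM = (k * wdeg mu h)%N.
  by rewrite /wdeg big_distrr; apply: eq_bigr => i _; rewrite mulmnE /=; ring.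
have gE : (g *+ m')%MM = (g' *+ m)%MM.
  have small k h : (k <= d)%N -> (wdeg w h <= wdeg w g + wdeg w g')%N ->
      (mdeg (h *+ k)%MM < b)%N.
    move=> kd hb; rewrite ltnS mdegMn mulnC leq_mul //.
    exact: leq_trans (mdeg_le_wdeg h w0) hb.
  apply: mu_inj; first by apply: small; [case/andP: md' | apply: leq_addr].
    by apply: small; [case/andP: md | apply: leq_addl].
  by rewrite !wM; apply: (natr_inj charK0).
move=> j; have := congr1 (fun x : 'X_{1..n} => x j) gE.
by rewrite /= !mulmnE mulnC [RHS]mulnC.
Qed.

Lemma coefficient_vertex : exists i0 g0, support i0 g0 /\
  forall i g, support i g -> forall j, (i * g0 j <= i0 * g j)%N.
Proof.
have [m [g mg]] := support_nonempty.
apply: (@single_vertex n d support _ faces_are_points m g mg).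
by move=> i h [].
Qed.

End QuasiOrdinary.

(** * The ideal of the coefficients *)

Lemma exponents_power n (K : comNzRingType) (f : mseries n K) (p q : nat)
    (g0 : 'X_{1..n}) :
  (forall g, scoef f g != 0 -> forall j, (p * g0 j <= q * g j)%N) ->
  forall k h, scoef (f ^+ k) h != 0 -> forall j, (k * (p * g0 j) <= q * h j)%N.
Proof.
move=> fE; elim=> [|k IH] h hk j; first by rewrite mul0n.
rewrite exprS in hk; apply: contraNT hk; rewrite -ltnNge => lt.
apply/eqP; apply: scoefMn_eq0 => a b hE.
have [->|fa] := eqVneq (scoef f a) 0; first by rewrite mul0r.
have [->|fb] := eqVneq (scoef (f ^+ k) b) 0; first by rewrite mulr0.
move: lt; rewrite ltnNge hE mnmDE mulnDr mulSn leq_add //.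
  exact: fE.
exact: IH.
Qed.

(** The discriminant is the resultant up to sign, and the resultant lies in the
    ideal of P and P'. *)
Lemma resultant_bezout n (K : fieldType) d (P : {poly mseries n K})
    (alpha : 'X_{1..n}) (U : mseries n K) :
  [pchar K] =i pred0 -> P \is monic -> size P = d.+1 -> (1 < d)%N ->
  scoef U 0%MM != 0 -> discriminant P = mseries_monom K alpha * U ->
  exists V W U', scoef U' 0%MM != 0 /\
    (mseries_monom K alpha * U')%:P = W * P + V * P^`().
Proof.
move=> charK0 mP sP d1 U0 discP.
have szP : (1 < size P)%N by rewrite sP ltnW.
have szP' : (1 < size P^`())%N.
  rewrite ltnNge; apply/negP => /leq_sizeP /(_ d.-1) H.
  have := H (_ : (0 < d.-1)%N); rewrite -subn1 subn_gt0 d1 => /(_ isT).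
  rewrite coef_deriv subn1 prednK ?(ltnW d1) //.
  have -> : P`_d = 1 by move/monicP: mP; rewrite lead_coefE sP.
  move/mseriesP/(_ 0%MM) => /=.
  have -> : scoef (1 *+ d : mseries n K) 0%MM = d%:R.
    by elim: (d) => [//|m IH]; rewrite !mulrS -IH /= eqxx.
  by move/eqP; rewrite (pcharf0P _).1 // eqn0Ngt (ltnW d1).
have [[W V] /= _ resE] := resultant_in_ideal szP szP'.
pose s : mseries n K := (-1) ^+ 'C((size P).-1, 2).
exists V, W, (s * U); split.
  rewrite /s -signr_odd; case: (odd _).
    by rewrite expr1 mulN1r /= oppr_eq0.
  by rewrite expr0 mul1r.
rewrite -resE; congr (_%:P); rewrite mulrCA -discP /discriminant mulrA -expr2.
by rewrite sqrr_sign mul1r.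
Qed.

Theorem theorem1p1 (K : closedFieldType) (charK0 : [pchar K] =i pred0)
    (n d : nat) (hd : (2 <= d)%N)
    (a : nat -> mseries n K) (P : {poly mseries n K})
    (hP : P = 'X^d + \sum_(1 <= i < d.+1) a i *: 'X^(d - i))
    (hqo : quasi_ordinary P) (hW : weierstrass P) (ha1 : a 1%N = 0) :
  exists i0 : nat,
    [/\ (2 <= i0 <= d)%N,
        monomial_times_unit (a i0 ^+ (d`! %/ i0)) &
        ideal_gen [seq a i ^+ (d`! %/ i) | i <- index_iota 2 d.+1]
          = ideal_gen [:: a i0 ^+ (d`! %/ i0)]].
Proof.
have [mP [alpha [U [U0 discP]]]] := hqo.
have Pcoef i : (0 < i <= d)%N -> P`_(d - i) = a i.
  move=> /andP[i0 id]; rewrite hP coefD coefXn coef_sum.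
  rewrite (bigD1_seq i) ?mem_index_iota ?iota_uniq ?i0 ?ltnS //=.
  rewrite coefZ coefXn eqxx mulr1 big_nat_cond big1 => [|k].
    by rewrite addr0 ltn_eqF ?add0r // ltn_subrL i0 (leq_trans i0).
  move=> /andP[/andP[k0]]; rewrite ltnS => kd ki; rewrite coefZ coefXn.
  by case: eqP => [e|_]; [move: ki; rewrite -(subKn kd) -e subKn // eqxx | rewrite mulr0].
have szP : size P = d.+1.
  rewrite hP size_polyDl size_polyXn //; apply/leq_sizeP => j jd.
  rewrite coef_sum big_nat_cond big1 // => i /andP[/andP[i0 _] _].
  by rewrite coefZ coefXn gtn_eqF ?mulr0 // (leq_trans _ jd) // ltn_subrL i0 (ltnW hd).
have P_sub : P`_d.-1 = 0 by rewrite -subn1 Pcoef /= ?ha1 ?(ltnW hd).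
have [V [W [U' [U'0 bezout]]]] := resultant_bezout charK0 mP szP hd U0 discP.
have [i0 [g0 [[i0d nz0] vertex]]] :=
  coefficient_vertex charK0 mP szP hd P_sub U'0 bezout.
have i0_gt0 : (0 < i0)%N by case/andP: i0d.
have i0_gt1 : (1 < i0)%N.
  rewrite ltn_neqAle i0_gt0 andbT; apply: contraNneq nz0 => e.
  by rewrite Pcoef // -e ha1.
rewrite Pcoef // in nz0.
have vert i g : (0 < i <= d)%N -> scoef (a i) g != 0 ->
    forall j, (i * g0 j <= i0 * g j)%N.
  by move=> id fg; apply: vertex; split=> //; rewrite Pcoef.
pose J := (d`! %/ i0)%N.
have factE i : (0 < i <= d)%N -> (d`! %/ i * i = d`!)%N.
  by move=> id; rewrite divnK // dvdn_fact.
(* The vertex inequalities i * g0 <= i0 * g for the exponents g of a_i become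
   independent of i for the power a_i^(d!/i). *)
have divides i : (0 < i <= d)%N -> exists q,
    a i ^+ (d`! %/ i) = mseries_monom K (g0 *+ J)%MM * q.
  move=> id; eexists; apply: monom_divides => h ah; apply/mnm_lepP => j.
  have := exponents_power (fun g fg => vert i g id fg) ah j.
  by rewrite mulnA factE // -(factE i0) // -/J mulnAC mulnC leq_pmul2l // mulmnE mulnC.
have [u [uu aE]] : exists u, u \is a GRing.unit /\
    a i0 ^+ J = mseries_monom K (g0 *+ J)%MM * u.
  have a0E := monom_divides (f := a i0) (a := g0).
  exists (MSeries (fun m => scoef (a i0) (m + g0)%MM) ^+ J); split.
    apply: unitrX; apply: (@mseries_unitP _ _ _ (scoef (a i0) g0)^-1).
    by rewrite /= add0m mulVf.
  rewrite -monomX -exprMn -a0E // => m am; apply/mnm_lepP => j.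
  by have := vert i0 m i0d am j; rewrite leq_pmul2l.
have gen i : (0 < i <= d)%N -> exists q, a i ^+ (d`! %/ i) = q * a i0 ^+ J.
  move=> id; have [q qE] := divides i id; exists (q / u).
  by rewrite aE qE mulrCA divrK.
exists i0; split.
- by rewrite i0_gt1; case/andP: i0d.
- by exists (g0 *+ J)%MM, u.
pose s := [seq a i ^+ (d`! %/ i) | i <- index_iota 2 d.+1].
have ss : size s = (d.+1 - 2)%N by rewrite size_map size_iota.
have sE k : (k < size s)%N -> s`_k = a (2 + k)%N ^+ (d`! %/ (2 + k)).
  by rewrite ss => kd; rewrite (nth_map 0%N) ?size_iota // nth_iota.
apply/seteqP; split=> x [c ->]; rewrite -/s.
  have /choice [q qE] : forall k, exists q, (k < size s)%N -> s`_k = q * a i0 ^+ J.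
    move=> k; case: (ltnP k (size s)) => [ks|_]; last by exists 0.
    have [|q qE] := gen (2 + k)%N; first by move: ks; rewrite ss; lia.
    by exists q => _; rewrite sE.
  exists (fun=> \sum_(k < size s) c k * q k); rewrite big_ord1 /= mulr_suml.
  by apply: eq_bigr => k _; rewrite qE // mulrA.
have i0s : (i0 - 2 < size s)%N by rewrite ss; case/andP: i0d; lia.
exists (fun k => if k == (i0 - 2)%N then c 0%N else 0).
rewrite big_ord1 (bigD1 (Ordinal i0s)) //= eqxx big1 ?addr0 => [|k].
  by rewrite sE // subnKC.
by rewrite -val_eqE /= => /negbTE ->; rewrite mul0r.
Qed.
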